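(* Let $T>0$, $f_0,f_T$ smooth, $K_1,K_2\ge1$ integers, and let $A$, $K$ and $t_1,\dots,t_K$ be as defined in the context. Put $$v^*(x)=\frac1K\sum_{i=1}^K t_i(x)+\frac{A_1}{2T},\qquad A_1=A-\int_{-T}^T\frac1K\sum_{i=1}^K t_i(x)\,dx,\qquad x\in[-T,T].$$ A pre-minimum-input solution for the $L^2$ metric always exists. Moreover, for every pre-minimum-input solution for the $L^2$ metric, the limit of its input sequence equals $v^*$ almost everywhere on $[-T,T]$.
   Context: TBVP: given smooth $f_0,f_T:\mathbb R\to\mathbb R$ and $T>0$, a solution is a function $u\in C^2([0,T]\times\mathbb R)$ with $u_{tt}-u_{xx}=0$, $u(0,x)=f_0(x)$, $u(T,x)=f_T(x)$. Its input is $v(x)=u_t(0,x)$; the set of all inputs is the input space. Metric: fix integers $K_1,K_2\ge 1$, put $K=K_1+K_2+1$; inputs are measured by the norm of $L^2[-(2K_1+1)T,(2K_2+1)T]$. A pre-minimum-input solution (PMS) is a sequence of solutions whose sequence of inputs converges, in $L^2[-(2K_1+1)T,(2K_2+1)T]$, to a function whose norm equals the infimum of the norms of all inputs. Constant: $A=2f_T(0)-f_0(T)-f_0(-T)$. Functions $t_i$ on $[-T,T]$, $i=1,\dots,K$: $t_1=0$; for $k=1,\dots,K_2$, $$t_{k+1}(x)=f_0'(x)+2\sum_{n=0}^{k-1}f_0'(x+(2k-2n)T)-2\sum_{n=0}^{k-1}f_T'(x+(2k-2n-1)T)-f_0'(x+2kT);$$ for $k=1,\dots,K_1$, $$t_{k+K_2+1}(x)=f_0'(x)+2\sum_{n=0}^{k-1}f_T'(x+(2n+1-2k)T)-2\sum_{n=0}^{k-1}f_0'(x+2(n+1-k)T)-f_0'(x-2kT).$$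 *)

(* Defs.v *)
From HB Require Import structures.
From mathcomp Require Import all_boot all_order all_algebra.
From mathcomp Require Import all_classical all_reals all_analysis.

Set Implicit Arguments.
Unset Strict Implicit.
Unset Printing Implicit Defensive.

Import Order.TTheory GRing.Theory Num.Theory.
Import numFieldNormedType.Exports.

Local Open Scope classical_set_scope.
Local Open Scope ring_scope.

Definition smooth (R : realType) (f : R -> R) : Prop :=
  forall (n : nat) (x : R), derivable (derive1n n f) x 1.

(* The closed strip [0, T] x R; a point is p = (t, x). Functions on the strip
   are represented by total functions on R * R whose values outside the strip
   are never inspected. *)
Definition strip (R : realType) (T : R) : set (R * R) :=
  [set p | 0 <= p.1 <= T].

(* Time derivatives are taken relative to [0, T]: two-sided for 0 < t < T and
   one-sided at t = 0 and t = T. *)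
Definition time_quotient (R : realType) (u : R * R -> R) (p : R * R) (h : R) :
    R := h^-1 * (u (p.1 + h, p.2) - u p).

Definition time_steps (R : realType) (T : R) (p : R * R) : set_system R :=
  within [set h | 0 <= p.1 + h <= T] 0^'.

Definition t_derivable (R : realType) (T : R) (u : R * R -> R) (p : R * R) :
    Prop := cvg (time_quotient u p h @[h --> time_steps T p]).

Definition dt (R : realType) (T : R) (u : R * R -> R) (p : R * R) : R :=
  lim (time_quotient u p h @[h --> time_steps T p]).

Definition x_derivable (R : realType) (u : R * R -> R) (p : R * R) : Prop :=
  derivable (fun y => u (p.1, y)) p.2 1.

Definition dx (R : realType) (u : R * R -> R) (p : R * R) : R :=
  derive1 (fun y => u (p.1, y)) p.2.

Fixpoint Ck_strip (R : realType) (T : R) (k : nat) (u : R * R -> R) : Prop :=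
  {within strip T, continuous u} /\
  match k with
  | 0 => True
  | j.+1 =>
      [/\ forall p, strip T p -> t_derivable T u p /\ x_derivable u p,
          Ck_strip T j (dt T u) & Ck_strip T j (dx u)]
  end.

Definition is_solution (R : realType) (T : R) (f0 fT : R -> R)
    (u : R * R -> R) : Prop :=
  [/\ Ck_strip T 2 u,
      forall p, strip T p -> dt T (dt T u) p - dx (dx u) p = 0,
      forall x, u (0, x) = f0 x
    & forall x, u (T, x) = fT x].

Definition input (R : realType) (T : R) (u : R * R -> R) (x : R) : R :=
  dt T u (0, x).

Definition input_space (R : realType) (T : R) (f0 fT : R -> R) :
    set (R -> R) :=
  [set v | exists2 u, is_solution T f0 fT u & v = input T u].

(* Elements of L^2(D) are represented through their extension by zero
   [v \_ D]. *)
Definition L2 (R : realType) (D : set R) (v : R -> R) : Prop :=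
  v \_ D \in Lfun lebesgue_measure 2%:E.

Definition L2norm (R : realType) (D : set R) (v : R -> R) : \bar R :=
  'N[lebesgue_measure]_2%:E[EFin \o (v \_ D)]%E.

Definition L2cvg (R : realType) (D : set R) (v_ : nat -> R -> R) (w : R -> R) :
    Prop :=
  L2norm D (v_ n \- w) @[n --> \oo] --> 0%E.

Definition metric_domain (R : realType) (T : R) (K1 K2 : nat) : set R :=
  `[- ((2 * K1%:R + 1) * T), (2 * K2%:R + 1) * T].

Definition is_PMS (R : realType) (T : R) (f0 fT : R -> R) (K1 K2 : nat)
    (u_ : nat -> R * R -> R) : Prop :=
  let D := metric_domain T K1 K2 in
  (forall n, is_solution T f0 fT (u_ n)) /\
  exists w : R -> R,
    [/\ L2 D w,
        L2cvg D (fun n => input T (u_ n)) w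
      & L2norm D w = ereal_inf [set L2norm D v | v in input_space T f0 fT]].

Definition constA (R : realType) (T : R) (f0 fT : R -> R) : R :=
  2 * fT 0 - f0 T - f0 (- T).

Definition t_right (R : realType) (T : R) (f0 fT : R -> R) (k : nat) (x : R) :
    R :=
  derive1 f0 x
  + 2 * (\sum_(0 <= n < k) derive1 f0 (x + (2 * k%:R - 2 * n%:R) * T))
  - 2 * (\sum_(0 <= n < k) derive1 fT (x + (2 * k%:R - 2 * n%:R - 1) * T))
  - derive1 f0 (x + 2 * k%:R * T).

Definition t_left (R : realType) (T : R) (f0 fT : R -> R) (k : nat) (x : R) :
    R :=
  derive1 f0 x
  + 2 * (\sum_(0 <= n < k) derive1 fT (x + (2 * n%:R + 1 - 2 * k%:R) * T))
  - 2 * (\sum_(0 <= n < k) derive1 f0 (x + 2 * (n%:R + 1 - k%:R) * T))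
  - derive1 f0 (x - 2 * k%:R * T).

(* The function t_i for 1 <= i <= K1 + K2 + 1: t_1 = 0,
   t_{k+1} = t_right k for 1 <= k <= K2, and
   t_{k+K2+1} = t_left k for 1 <= k <= K1. *)
Definition t_fun (R : realType) (T : R) (f0 fT : R -> R) (K2 i : nat) : R -> R :=
  if (i <= 1)%N then fun=> 0
  else if (i <= K2.+1)%N then t_right T f0 fT (i - 1)
  else t_left T f0 fT (i - K2.+1).

Definition t_mean (R : realType) (T : R) (f0 fT : R -> R) (K1 K2 : nat)
    (x : R) : R :=
  let K := (K1 + K2 + 1)%N in
  K%:R^-1 * \sum_(1 <= i < K.+1) t_fun T f0 fT K2 i x.

Definition constA1 (R : realType) (T : R) (f0 fT : R -> R) (K1 K2 : nat) : R :=
  constA T f0 fT -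
  \int[lebesgue_measure]_(x in `[- T, T]) t_mean T f0 fT K1 K2 x.

Definition vstar (R : realType) (T : R) (f0 fT : R -> R) (K1 K2 : nat)
    (x : R) : R :=
  t_mean T f0 fT K1 K2 x + constA1 T f0 fT K1 K2 / (2 * T).

(* Main.v *)
Require Import Defs.
From HB Require Import structures.
From mathcomp Require Import all_boot all_order all_algebra.
From mathcomp Require Import all_classical all_reals all_analysis.
From mathcomp Require Import measurable_realfun ring lra.

Set Implicit Arguments.
Unset Strict Implicit.
Unset Printing Implicit Defensive.

Import Order.TTheory GRing.Theory Num.Theory.
Import numFieldNormedType.Exports.

Local Open Scope classical_set_scope.
Local Open Scope ring_scope.

(** For a solution u put v = u_t(0, .).  The Riemann invariant u_t - u_x is
    constant along the lines x - t = const, which gives d'Alembert's formula at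
    time T ([solution_dAlembert]):
      2 fT(x) = f0(x+T) + f0(x-T) + (integral of v over [x-T, x+T]).
    Conversely a C1 function v that satisfies this formula is the input of the
    solution a(x+t) + b(x-t), where a = (f0+V)/2, b = (f0-V)/2 and V' = v
    ([input_exists]).  Differentiating the formula, it says that
      v(x+2T) = v(x) - t_2(x) for all x,  and the integral of v over [-T, T] is A
    ([input_space_quasi_periodic], [quasi_periodic_input_space]).  So v is
    determined by its values on [-T, T]: on each of the K translates of [-T, T]
    that tile the metric domain it is v - t_i.

    Let m be the extension of v* from [-T, T) to the line by the same law.  For
    an input v the difference v - m is 2T-periodic with integral 0 over a
    period, while the K copies of m sum up to K v* minus the sum of the t_i,
    which is a constant.  Hence m is orthogonal to v - m and
      |v|^2 = |m|^2 + |v - m|^2          ([input_pythagoras]).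
    In general m is discontinuous, hence no input, but inputs come arbitrarily
    close to it: adding to v* a C1 function with integral 0, small L2 norm and
    prescribed jumps of its value and derivative between -T and T
    ([small_correction]) makes the extension C1 ([quasi_periodic_C1],
    [input_space_approximation]).  So the infimum of the norms is |m|, a
    sequence of inputs tending to m exists, and by the Pythagorean identity any
    sequence of inputs whose norms tend to |m| converges to m
    ([minimizing_cvg]); limits in L2 being unique almost everywhere, the limit
    is v* on [-T, T]. *)

(** * Derivatives and primitives of functions of a real variable *)

Section calculus.
Context {R : realType}.
Implicit Types (f g : R -> R).
Notation mu := (@lebesgue_measure R).

Lemma is_derive1P f (x d : R) :
  is_derive x 1 f d <-> h^-1 * (f (x + h) - f x) @[h --> 0^'] --> d.
Proof.
have E : (fun h : R => h^-1 *: ((f \o shift x) (h *: 1) - f x)) =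
         (fun h => h^-1 * (f (x + h) - f x)).
  by apply/funext => h; rewrite /= scaler1 [h + x]addrC.
split=> [[]|fd].
  by rewrite /derivable /derive E => ? <-.
have H : h^-1 *: ((f \o shift x) (h *: 1) - f x) @[h --> 0^'] --> d by rewrite E.
by apply: DeriveDef; [apply/cvg_ex; exists d | exact: cvg_lim H].
Qed.

Lemma is_derive1D f g (x a b : R) : is_derive x 1 f a -> is_derive x 1 g b ->
  is_derive x 1 (fun y => f y + g y) (a + b).
Proof. exact: is_deriveD. Qed.

Lemma is_derive1B f g (x a b : R) : is_derive x 1 f a -> is_derive x 1 g b ->
  is_derive x 1 (fun y => f y - g y) (a - b).
Proof. exact: is_deriveB. Qed.

Lemma is_derive1Z f (c x a : R) : is_derive x 1 f a ->
  is_derive x 1 (fun y => c * f y) (c * a).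
Proof. exact: is_deriveZ. Qed.

Lemma is_derive1_affine f (c d x a : R) : is_derive (c * x + d) 1 f a ->
  is_derive x 1 (fun y => f (c * y + d)) (c * a).
Proof.
move=> df; rewrite mulrC; apply: (is_derive1_comp (g := fun y => c * y + d)) => //.
rewrite -[c in is_derive _ _ _ c]mulr1 -[X in is_derive _ _ _ X]addr0.
exact: is_deriveD.
Qed.

Lemma is_derive_continuous f f' :
  (forall x : R, is_derive x 1 f (f' x)) -> continuous f.
Proof.
move=> df x; apply: differentiable_continuous.
by apply/derivable1_diffP; apply: ex_derive.
Qed.

Lemma integrable_itv f (a b : R) : continuous f ->
  mu.-integrable `[a, b] (EFin \o f).
Proof.
move=> cf; apply: continuous_compact_integrable; first exact: segment_compact.
exact: continuous_subspaceT.
Qed.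

Lemma Rintegral_FTC f F (a b : R) : a < b -> continuous f ->
  (forall x : R, is_derive x 1 F (f x)) ->
  \int[mu]_(x in `[a, b]) f x = F b - F a.
Proof.
move=> ab cf dF; rewrite /Rintegral (continuous_FTC2 ab (F := F)) //.
- exact: continuous_subspaceT.
- have cF := is_derive_continuous dF.
  split=> [x _||]; first exact: ex_derive.
  + exact/cvg_at_right_filter/cF.
  + exact/cvg_at_left_filter/cF.
- by move=> x _; rewrite derive1E derive_val.
Qed.

(** The integral from -oo is a primitive on the whole line, since the
    integrand vanishes on the left half-line. *)
Let primitive_right f : continuous f -> (forall x, x <= 0 -> f x = 0) ->
  exists F, forall x : R, is_derive x 1 F (f x).
Proof.
move=> cf f0; exists (fun x => \int[mu]_(t in `]-oo, x]) f t) => x.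
have int_f : mu.-integrable `]-oo, (x + 1)] (EFin \o f).
  have := integrable_itv 0 (x + 1) cf.
  have <- : `]-oo, x + 1] `&` `[0, x + 1] = `[0, x + 1]%classic.
    by apply: setIidr => y /=; rewrite !in_itv/= => /andP[].
  rewrite integrable_restrict//; apply: eq_integrable => // y.
  rewrite inE /= in_itv /= => yx; rewrite patchE; case: ifPn => //.
  rewrite notin_setE /= in_itv /= yx andbT => /negP; rewrite -ltNge => y0.
  by rewrite f0// ltW.
have [] := @continuous_FTC1 R f -oo%O x (x + 1) _ int_f _ (cf x); first by rewrite ltrDl.
  by rewrite ltNyr.
by move=> dF F'; apply: DeriveDef => //; rewrite -derive1E.
Qed.

(** Integrals from a fixed base point only provide a primitive to the right
    of it; the left half-line is handled by reflection. *)
Lemma primitive_exists f : continuous f ->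
  exists F, forall x : R, is_derive x 1 F (f x).
Proof.
move=> cf.
have cmax (s : R) : continuous (fun x : R => f (s * (2^-1 * (x + `|x|))) - f 0).
  move=> x; apply: cvgB; last exact: cvg_cst.
  apply: (@continuous_comp _ _ _ (fun x : R => s * (2^-1 * (x + `|x|))) f);
    last exact: cf.
  apply: cvgM; first exact: cvg_cst.
  apply: cvgM; first exact: cvg_cst.
  by apply: cvgD; [exact: cvg_id | exact: norm_continuous].
have max0 (s x : R) : x <= 0 -> f (s * (2^-1 * (x + `|x|))) - f 0 = 0.
  by move=> x0; rewrite ler0_norm// subrr !mulr0 subrr.
have [F1 dF1] := primitive_right (cmax 1) (max0 1).
have [F2 dF2] := primitive_right (cmax (-1)) (max0 (-1)).
(* f is the sum of its restrictions to the two half-lines, frozen at f 0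
   elsewhere, minus f 0. *)
exists (fun x => F1 x - F2 (- 1 * x + 0) + f 0 * x) => x.
have dF2x : is_derive x 1 (fun y => F2 (-1 * y + 0)) _ :=
  is_derive1_affine (dF2 _).
have := is_derive1D (is_derive1B (dF1 x) dF2x) (is_derive1Z (f 0) (is_derive_id x 1)).
move/is_derive_eq; apply; rewrite mulr1 !mulN1r mul1r addr0 normrN.
have [x0|x0] := ger0P x.
  have -> : 2^-1 * (x + x) = x by field.
  by rewrite addNr mulr0 oppr0 subrr oppr0 subr0 subrK.
rewrite subrr mulr0.
have -> : 2^-1 * (- x + - x) = - x by field.
by rewrite subrr sub0r !opprK subrK.
Qed.

(** The increments in the limits below have either sign. *)
Lemma MVT_between f f' (a b : R) :
  (forall y, `|y - a| <= `|b - a| -> is_derive y 1 f (f' y)) ->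
  exists2 c, `|c - a| <= `|b - a| & f b - f a = f' c * (b - a).
Proof.
move=> df.
have cont (x y : R) : (forall z, z \in `[x, y] -> is_derive z 1 f (f' z)) ->
    {within `[x, y], continuous f}.
  move=> dxy; apply: derivable_within_continuous => z zxy.
  exact: (ex_derive (is_derive := dxy z zxy)).
have [ab|ba] := leP a b.
  have ab_sub z : z \in `[a, b] -> `|z - a| <= `|b - a|.
    by rewrite in_itv/= => /andP[? ?]; rewrite !ger0_norm ?subr_ge0// lerB.
  have [z zab||c /ab_sub cab ->] := @MVT_segment R f f' a b ab; last by exists c.
  - by apply/df/ab_sub; exact: subset_itv_oo_cc.
  - by apply: cont => z /ab_sub; exact: df.
have ab_sub z : z \in `[b, a] -> `|z - a| <= `|b - a|.
  rewrite in_itv/= => /andP[? ?].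
  by rewrite !ler0_norm ?subr_le0 ?(ltW ba)// lerN2 lerB.
have [z zab||c /ab_sub cab E] := @MVT_segment R f f' b a (ltW ba).
- by apply/df/ab_sub; exact: subset_itv_oo_cc.
- by apply: cont => z /ab_sub; exact: df.
- by exists c => //; rewrite -opprB E -mulrN opprB.
Qed.

(** The chain rule on a line, without total differentiability: the increment
    splits into a step in t at fixed x and a step in x at time t + h, and the
    latter is evaluated by the mean value theorem and the continuity of [ux]. *)
Lemma is_derive_along_line (u ux : R * R -> R) (ut t c s : R) :
  (\forall q \near (t, c + s * t), is_derive (q.2 : R) 1 (fun y => u (q.1, y)) (ux q)) ->
  {for (t, c + s * t), continuous ux} ->
  is_derive t 1 (fun r => u (r, c + s * t)) ut ->
  is_derive t 1 (fun r => u (r, c + s * r)) (ut + s * ux (t, c + s * t)).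
Proof.
set x := c + s * t => dux cux /is_derive1P dut; apply/is_derive1P.
have -> : (fun h => h^-1 * (u (t + h, c + s * (t + h)) - u (t, c + s * t))) =
  (fun h => h^-1 * (u (t + h, x) - u (t, x))) \+
  (fun h => h^-1 * (u (t + h, x + s * h) - u (t + h, x))).
  apply/funext => h /=; have -> : c + s * (t + h) = x + s * h by rewrite /x; ring.
  by ring.
apply: cvgD => //; apply/cvgrPdist_le => /= e e0.
have s1 : 0 < `|s| + 1 by rewrite ltr_pwDr.
have /cvgrPdist_lt /(_ (e / (`|s| + 1))) := cux.
rewrite divr_gt0// => /(_ isT) ce.
have [/= d d0 dP] := (nbhs_ballP (t, x) _).1 (filterI dux ce).
near=> h.
have h0 : h != 0 by near: h; exact: nbhs_dnbhs_neq.
have hd : `|h| < d.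
  by near: h; apply: dnbhs0_lt.
have shd : `|s * h| < d.
  have : `|h| < d / (`|s| + 1) by near: h; apply: dnbhs0_lt; rewrite divr_gt0.
  rewrite ltr_pdivlMr// normrM [`|s| * _]mulrC => /(le_lt_trans _); apply.
  by rewrite ler_wpM2l// lerDl.
have inball y : `|y - x| <= `|s * h| -> ball (t, x) d (t + h, y).
  move=> yx; split; rewrite /ball /=; first by rewrite opprD addrA subrr sub0r normrN.
  by rewrite distrC (le_lt_trans yx).
have [|y yx ->] := @MVT_between (fun y => u (t + h, y)) (fun y => ux (t + h, y)) x (x + s * h).
  by move=> y; rewrite addrAC subrr add0r => /inball/dP[].
rewrite addrAC subrr add0r in yx *.
have [_ /ltW uxe] := dP _ (inball _ yx).
rewrite (_ : h^-1 * _ = s * ux (t + h, y)); last by field.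
rewrite -mulrBr normrM.
apply: (@le_trans _ _ (`|s| * (e / (`|s| + 1)))); first exact: ler_wpM2l.
rewrite mulrCA ler_piMr// ?(ltW e0)// ler_pdivrMr// mul1r lerDl//.
Unshelve. all: by end_near. Qed.

(** Symmetry of second derivatives: the mean value theorem, applied twice in
    either order, writes the same second difference of u over a small square
    as a value of [u12] and as a value of [u21], times the area. *)
Lemma mixed_partials (u u1 u2 u12 u21 : R * R -> R) (p : R * R) :
  (\forall q \near p, is_derive (q.1 : R) 1 (fun t => u (t, q.2)) (u1 q)) ->
  (\forall q \near p, is_derive (q.2 : R) 1 (fun y => u (q.1, y)) (u2 q)) ->
  (\forall q \near p, is_derive (q.2 : R) 1 (fun y => u1 (q.1, y)) (u12 q)) ->
  (\forall q \near p, is_derive (q.1 : R) 1 (fun t => u2 (t, q.2)) (u21 q)) ->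
  {for p, continuous u12} -> {for p, continuous u21} -> u12 p = u21 p.
Proof.
case: p => t x d1 d2 d12 d21 c12 c21.
apply/eqP; rewrite -subr_eq0 -normr_le0; apply/ler_addgt0Pl => e e0.
rewrite addr0.
have e20 : 0 < e / 2 by rewrite divr_gt0.
move/cvgrPdist_lt : c12 => /(_ _ e20) c12.
move/cvgrPdist_lt : c21 => /(_ _ e20) c21.
have [/= d d0 dP] := (nbhs_ballP (t, x) _).1
  (filterI (filterI (filterI d1 d2) (filterI d12 d21)) (filterI c12 c21)).
pose h := d / 2.
have h0 : h != 0 by rewrite gt_eqF// divr_gt0.
have box a b : `|a - t| <= `|t + h - t| -> `|b - x| <= `|x + h - x| ->
    ball (t, x) d (a, b).
  have hd : `|h| < d by rewrite gtr0_norm ?divr_gt0// ltr_pdivrMr//; lra.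
  rewrite !(addrAC _ h) !subrr !add0r => ta tb.
  by split; rewrite /ball/= distrC (le_lt_trans _ hd).
have t_in : `|t - t| <= `|t + h - t| by rewrite subrr normr0.
have x_in : `|x - x| <= `|x + h - x| by rewrite subrr normr0.
have [|a ta Ea] := @MVT_between (fun r => u (r, x + h) - u (r, x))
    (fun r => u1 (r, x + h) - u1 (r, x)) t (t + h).
  move=> r rt; apply: is_derive1B.
    by case: (dP (r, x + h)) => [|[[]]//]; exact: box.
  by case: (dP (r, x)) => [|[[]]//]; exact: box.
have [|b xb Eb] := @MVT_between (fun y => u1 (a, y)) (fun y => u12 (a, y)) x (x + h).
  by move=> y yx; case: (dP (a, y)) => [|[_ []]//]; exact: box.
have [|b' xb' Eb'] := @MVT_between (fun y => u (t + h, y) - u (t, y))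
    (fun y => u2 (t + h, y) - u2 (t, y)) x (x + h).
  move=> y yx; apply: is_derive1B.
    by case: (dP (t + h, y)) => [|[[]]//]; exact: box.
  by case: (dP (t, y)) => [|[[]]//]; exact: box.
have [|a' ta' Ea'] := @MVT_between (fun r => u2 (r, b')) (fun r => u21 (r, b')) t (t + h).
  by move=> r rt; case: (dP (r, b')) => [|[_ []]//]; exact: box.
have E : u12 (a, b) = u21 (a', b').
  apply: (mulIf h0); apply: (mulIf h0).
  move: Ea Eb Ea' Eb'; rewrite !(addrAC _ h) !subrr !add0r.
  by move=> Ea <- <- <-; rewrite -Ea; ring.
have [_ [e1 _]] := dP _ (box _ _ ta xb).
have [_ [_ e2]] := dP _ (box _ _ ta' xb').
rewrite /= in e1 e2.
rewrite (_ : u12 (t, x) - u21 (t, x) =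
  (u12 (t, x) - u12 (a, b)) - (u21 (t, x) - u21 (a', b'))); last first.
  by rewrite E; ring.
rewrite (le_trans (ler_normB _ _))// [leRHS]splitr; apply/ltW; exact: ltrD.
Qed.

End calculus.

(** * The wave equation on the strip *)

Section strip.
Context {R : realType} (T : R).
Hypothesis T_gt0 : 0 < T.
Implicit Types (u w : R * R -> R) (p : R * R) (f : R -> R).

Lemma near_open_strip p : 0 < p.1 < T -> \forall q \near p, 0 < q.1 < T.
Proof.
move=> /andP[p0 pT].
have fst_p : q.1 @[q --> p] --> p.1 by exact: cvg_fst.
near=> q; apply/andP; split; near: q; rewrite /=.
- exact: cvgr_gt fst_p _ p0.
- exact: cvgr_lt fst_p _ pT.
Unshelve. all: by end_near. Qed.

Lemma within_strip_interior w p :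
  {within strip T, continuous w} -> 0 < p.1 < T -> {for p, continuous w}.
Proof.
move=> /subspace_continuousP cw pT U /cw.
have pS : strip T p by case/andP: pT => ? ?; rewrite /strip/= !ltW.
move=> /(_ pS); rewrite /= /within /= => pU.
apply: filterS2 (near_open_strip pT) pU => q /andP[? ?]; apply.
by rewrite /strip/= !ltW.
Qed.

Lemma within_strip_line w (c s : R) : {within strip T, continuous w} ->
  {within `[0, T], continuous (fun t => w (t, c + s * t))}.
Proof.
move=> /subspace_continuousP cw; apply/subspace_continuousP => t.
rewrite /= in_itv/= => tT; have pS : strip T (t, c + s * t) by [].
have line_t : (r, c + s * r) @[r --> t] --> (t, c + s * t).
  apply: (@cvg_pair _ _ _ _ (nbhs t) (nbhs (c + s * t))); first exact: cvg_id.
  by apply: cvgD; [exact: cvg_cst | apply: cvgM; [exact: cvg_cst | exact: cvg_id]].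
by have := cw _ pS; apply: cvg_comp => U /line_t.
Qed.

(** At interior times small steps are all admissible, so the relative
    derivative is the ordinary one. *)
Lemma dt_interior u p : 0 < p.1 < T -> t_derivable T u p ->
  is_derive (p.1 : R) 1 (fun t => u (t, p.2)) (dt T u p).
Proof.
case: p => t x pT du; apply/is_derive1P => U /du du_U.
have near_pT : \forall h \near (0 : R)^', 0 <= t + h <= T.
  have t_0 : t + h @[h --> (0 : R)^'] --> t.
    rewrite -[X in _ --> X]addr0; apply: cvgD; first exact: cvg_cst.
    exact: nbhs_dnbhs.
  case/andP: pT => t0 tT; near=> h; apply/andP; split; apply/ltW; near: h.
  - exact: cvgr_gt t_0 _ t0.
  - exact: cvgr_lt t_0 _ tT.
change (\forall h \near (0 : R)^', U (h^-1 * (u (t + h, x) - u (t, x)))).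
by apply: filterS2 near_pT du_U => h hT; apply.
Unshelve. all: by end_near. Qed.

(** This needs 0 < T: there must be admissible steps on one side at least. *)
Lemma time_steps_proper p : strip T p -> ProperFilter (time_steps T p).
Proof.
rewrite /strip /= => /andP[p0 pT]; apply: Build_ProperFilter.
move=> /nbhs_ballP[/= d d0 dP].
have [tT|Tt] := ltP p.1 T.
  pose h := Num.min d (T - p.1) / 2.
  have m0 : 0 < Num.min d (T - p.1) by rewrite lt_min d0 subr_gt0.
  have h0 : 0 < h by rewrite divr_gt0.
  apply: (dP h); rewrite /ball /= ?gt_eqF//.
  - rewrite sub0r normrN gtr0_norm// ltr_pdivrMr//.
    by rewrite (@le_lt_trans _ _ d) ?ge_min ?lexx// ltr_pMr// ltr1n.
  - rewrite addr_ge0 ?(ltW h0)//= -lerBrDl ler_pdivrMr//.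
    by rewrite (@le_trans _ _ (T - p.1)) ?ge_min ?lexx ?orbT// ler_pMr ?ler1n// subr_gt0.
pose h := - (Num.min d T / 2).
have m0 : 0 < Num.min d T by rewrite lt_min d0.
have h0 : h < 0 by rewrite oppr_lt0 divr_gt0.
have pE : p.1 = T by apply/eqP; rewrite eq_le pT Tt.
apply: (dP h); rewrite /ball /= ?lt_eqF//.
- rewrite sub0r normrN ltr0_norm// opprK ltr_pdivrMr//.
  by rewrite (@le_lt_trans _ _ d) ?ge_min ?lexx// ltr_pMr// ltr1n.
- rewrite pE; apply/andP; split; last by rewrite gerDl ltW.
  rewrite subr_ge0 ler_pdivrMr//.
  by rewrite (@le_trans _ _ T) ?ge_min ?lexx ?orbT// ler_pMr ?ler1n.
Qed.

(** The converse transfer holds on the whole closed strip, provided that u is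
    differentiable on both sides of the boundary time. *)
Lemma dtP u p (d : R) : strip T p -> is_derive (p.1 : R) 1 (fun t => u (t, p.2)) d ->
  t_derivable T u p /\ dt T u p = d.
Proof.
move=> pS /is_derive1P du.
have PF := time_steps_proper pS.
have H : time_quotient u p h @[h --> time_steps T p] --> d.
  case: p du {pS PF} => t x du.
  by apply: cvg_trans du; apply: cvg_app; exact: cvg_within.
by split; [apply/cvg_ex; exists d | exact: cvg_lim H].
Qed.

Lemma dxP u p : x_derivable u p ->
  is_derive (p.2 : R) 1 (fun y => u (p.1, y)) (dx u p).
Proof. by move=> du; rewrite /dx derive1E; exact: derivableP. Qed.

Lemma C1_strip_line w (t c s : R) : Ck_strip T 1 w -> 0 < t < T ->
  is_derive t 1 (fun r => w (r, c + s * r))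
    (dt T w (t, c + s * t) + s * dx w (t, c + s * t)).
Proof.
move=> [_ [dw [_ _] [cdx _]]] tT.
have strip_t : strip T (t, c + s * t).
  by case/andP: tT => ? ?; rewrite /strip/= !ltW.
apply: is_derive_along_line.
- apply: filterS (near_open_strip (p := (t, _)) tT) => q /andP[? ?].
  by apply/dxP; apply: (dw q _).2; rewrite /strip/= !ltW.
- exact: within_strip_interior.
- exact: (dt_interior (p := (t, _)) tT (dw _ strip_t).1).
Qed.

(** Differentiability is only available at interior times; continuity covers
    the two ends. *)
Lemma strip_line_cst (g : R -> R) : {within `[0, T], continuous g} ->
  (forall t, 0 < t < T -> is_derive t 1 g 0) ->
  forall t, 0 <= t <= T -> g t = g 0.
Proof.
move=> cg dg t /andP[t0 tT]; apply/eqP; rewrite -subr_eq0.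
have [||c _ ->] := @MVT_segment R g (fun=> 0) 0 t t0; last by rewrite mul0r.
- move=> r; rewrite in_itv/= => /andP[r0 rt]; apply: dg.
  by rewrite r0 (lt_le_trans rt).
- apply: continuous_subspaceW cg => r /=; rewrite !in_itv/= => /andP[-> rt].
  exact: le_trans rt tT.
Qed.

Section solution.
Variables (f0 fT : R -> R) (u : R * R -> R).
Hypothesis u_sol : is_solution T f0 fT u.

Let C2u : Ck_strip T 2 u. Proof. by case: u_sol. Qed.
Let C1u : Ck_strip T 1 u.
Proof. by have [cu [du [cdt _] [cdx _]]] := C2u; split; [exact: cu | split]. Qed.
Let C1dtu : Ck_strip T 1 (dt T u). Proof. by have [_ [_ C _]] := C2u; exact: C. Qed.
Let C1dxu : Ck_strip T 1 (dx u). Proof. by have [_ [_ _ C]] := C2u; exact: C. Qed.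

Lemma solution_mixed_partials p : 0 < p.1 < T ->
  dx (dt T u) p = dt T (dx u) p.
Proof.
move=> pT; have near_S : \forall q \near p, 0 < q.1 < T /\ strip T q.
  apply: filterS (near_open_strip pT) => q qT; split => //.
  by case/andP: qT => ? ?; rewrite /strip/= !ltW.
have [_ [du _ _]] := C1u.
have [_ [ddt _ [cxt _]]] := C1dtu.
have [_ [ddx [ctx _] _]] := C1dxu.
apply: (@mixed_partials R u (dt T u) (dx u)).
- by apply: filterS near_S => q [qT /du[+ _]]; exact: dt_interior.
- by apply: filterS near_S => q [qT /du[_]]; exact: dxP.
- by apply: filterS near_S => q [qT /ddt[_]]; exact: dxP.
- by apply: filterS near_S => q [qT /ddx[+ _]]; exact: dt_interior.
- exact: within_strip_interior.
- exact: within_strip_interior.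
Qed.

(** By the wave equation and the symmetry of the mixed derivatives,
    (d_t + d_x)(u_t - u_x) = u_tt - u_xx = 0. *)
Lemma solution_invariant (c t : R) : 0 <= t <= T ->
  dt T u (t, c + t) - dx u (t, c + t) = input T u c - derive1 f0 c.
Proof.
move=> tT; pose q r := dt T u (r, c + 1 * r) - dx u (r, c + 1 * r).
have : q t = q 0; last first.
  rewrite /q mul1r mulr0 addr0 => ->.
  rewrite /input /dx /=; congr (_ - _); congr (derive1 _ c).
  by apply/funext => x; case: u_sol.
apply: strip_line_cst tT.
- apply: within_continuousB; apply: within_strip_line.
    exact: C1dtu.1.
  exact: C1dxu.1.
- move=> r rT; have := is_derive1B (C1_strip_line c 1 C1dtu rT) (C1_strip_line c 1 C1dxu rT).
  move/is_derive_eq; apply.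
  have rS : strip T (r, c + 1 * r) by case/andP: rT => ? ?; rewrite /strip/= !ltW.
  rewrite !mul1r in rS *; rewrite -solution_mixed_partials//.
  have [_ + _ _] := u_sol; move=> /(_ _ rS); lra.
Qed.

Lemma input_continuous : continuous (input T u).
Proof.
move=> x.
have [/subspace_continuousP cdt _] := C1dtu.
have x0 : strip T (0, x) by rewrite /strip/= lexx ltW.
have pt_x : (0, y) @[y --> x] --> within (strip T) (nbhs ((0 : R), x)).
  have pt : (0, y) @[y --> x] --> nbhs ((0 : R), x).
    by apply: (@cvg_pair _ _ _ _ (nbhs 0) (nbhs x)); [exact: cvg_cst|exact: cvg_id].
  move=> U /pt; apply: (@filterS _ (nbhs x)) => y; apply.
  by rewrite /strip/= lexx ltW.
exact: cvg_comp pt_x (cdt _ x0).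
Qed.

(** Along the line x + t = const through (T, x) the derivative of u is
    u_t - u_x, which [solution_invariant] expresses by the data at time 0; its
    primitive is the function [W] below, up to the factor -1/2. *)
Lemma solution_dAlembert V : (forall x : R, is_derive x 1 f0 (derive1 f0 x)) ->
  (forall x : R, is_derive x 1 V (input T u x)) ->
  forall x, 2 * fT x = f0 (x + T) + f0 (x - T) + (V (x + T) - V (x - T)).
Proof.
move=> df0 dV x; have [_ _ u0 uT] := u_sol.
pose W (y : R) : R := V y - f0 y.
have dW (y : R) : is_derive y 1 W (input T u y - derive1 f0 y) by exact: is_derive1B.
pose h (t : R) : R := u (t, (x + T) + -1 * t) + 2^-1 * W (-2 * t + (x + T)).
have hT : h T = h 0.
  apply: strip_line_cst; last by rewrite lexx ltW.
  - apply: within_continuousD; first exact: within_strip_line C1u.1.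
    apply: continuous_subspaceT => t; apply: cvgM; first exact: cvg_cst.
    apply: (@continuous_comp R R R (fun t : R => -2 * t + (x + T)) W).
      apply: cvgD; last exact: cvg_cst.
      by apply: cvgM; [exact: cvg_cst | exact: cvg_id].
    exact: (is_derive_continuous dW).
  - move=> t tT.
    have dWt := is_derive1_affine (dW (-2 * t + (x + T))).
    have := is_derive1D (C1_strip_line (x + T) (-1) C1u tT) (is_derive1Z 2^-1 dWt).
    move/is_derive_eq; apply.
    rewrite -(@solution_invariant _ t); last by case/andP: tT => ? ?; rewrite !ltW.
    rewrite (_ : -2 * t + (x + T) + t = x + T + -1 * t); last by ring.
    by field.
move: hT; rewrite /h !mulr0 add0r addr0 u0.
rewrite (_ : x + T + -1 * T = x); last by ring.
rewrite (_ : -2 * T + (x + T) = x - T); last by ring.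
by rewrite uT /W; lra.
Qed.

End solution.

(** Admissible time steps stay in the strip, so the time derivative at a point
    of the strip only depends on values there. *)
Lemma time_quotient_ext w w' p : {in strip T, w =1 w'} -> strip T p ->
  time_quotient w p h @[h --> time_steps T p] =
  time_quotient w' p h @[h --> time_steps T p].
Proof.
move=> ww' pS.
have E : {in [set h | 0 <= p.1 + h <= T], time_quotient w p =1 time_quotient w' p}.
  by move=> h; rewrite inE => hT; rewrite /time_quotient !ww'// inE.
rewrite eqEsubset; split=> U; apply: (@filterS _ (0^')) => h Uh hT.
  by have := Uh hT; rewrite /= E// inE.
by have := Uh hT; rewrite /= -E// inE.
Qed.

Lemma Ck_strip_ext k w w' : {in strip T, w =1 w'} ->
  Ck_strip T k w -> Ck_strip T k w'.
Proof.
elim: k w w' => [|k IH] w w' ww'.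
  move=> [cw _]; split => //.
  exact: subspace_eq_continuous cw.
have space p : strip T p -> (fun y => w (p.1, y)) = (fun y => w' (p.1, y)).
  by move=> pS; apply/funext => y; rewrite ww'// inE.
move=> [cw [dw Cdt Cdx]]; split; first exact: subspace_eq_continuous cw.
split.
- move=> p pS; have [dtw dxw] := dw p pS.
  by rewrite /t_derivable -(time_quotient_ext ww')// /x_derivable -space.
- by apply: IH Cdt => p; rewrite inE => pS; rewrite /dt (time_quotient_ext ww').
- by apply: IH Cdx => p; rewrite inE => pS; rewrite /dx space.
Qed.

Definition travelling (a b : R -> R) : R * R -> R :=
  fun p => a (p.2 + p.1) + b (p.2 - p.1).

Lemma travelling_continuous a b : continuous a -> continuous b ->
  continuous (travelling a b).
Proof.
move=> ca cb p; apply: cvgD.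
- apply: (@continuous_comp _ _ _ (fun p : R * R => p.2 + p.1) a); last exact: ca.
  by apply: cvgD; [exact: cvg_snd | exact: cvg_fst].
- apply: (@continuous_comp _ _ _ (fun p : R * R => p.2 - p.1) b); last exact: cb.
  by apply: cvgB; [exact: cvg_snd | exact: cvg_fst].
Qed.

Lemma is_derive_travelling_t a a' b b' p :
  (forall x : R, is_derive x 1 a (a' x)) -> (forall x : R, is_derive x 1 b (b' x)) ->
  is_derive (p.1 : R) 1 (fun t => travelling a b (t, p.2))
    (travelling a' (fun x => - b' x) p).
Proof.
move=> da db; rewrite /travelling /=.
have := is_derive1D (is_derive1_affine (c := 1) (x := p.1) (d := p.2) (da _))
  (is_derive1_affine (c := -1) (x := p.1) (d := p.2) (db _)).
rewrite !mul1r !mulN1r !(addrC _ p.2).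
by under eq_fun do rewrite !mul1r !mulN1r !(addrC _ p.2).
Qed.

Lemma is_derive_travelling_x a a' b b' p :
  (forall x : R, is_derive x 1 a (a' x)) -> (forall x : R, is_derive x 1 b (b' x)) ->
  is_derive (p.2 : R) 1 (fun y => travelling a b (p.1, y)) (travelling a' b' p).
Proof.
move=> da db; rewrite /travelling /=.
have := is_derive1D (is_derive1_affine (c := 1) (x := p.2) (d := p.1) (da _))
  (is_derive1_affine (c := 1) (x := p.2) (d := - p.1) (db _)).
rewrite !mul1r.
by under eq_fun do rewrite !mul1r.
Qed.

Lemma dx_travelling a a' b b' :
  (forall x : R, is_derive x 1 a (a' x)) -> (forall x : R, is_derive x 1 b (b' x)) ->
  dx (travelling a b) = travelling a' b'.
Proof.
move=> da db; apply/funext => p; rewrite /dx derive1E.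
exact: (derive_val (is_derive := is_derive_travelling_x p da db)).
Qed.

Lemma travelling_C1 a a' b b' :
  (forall x : R, is_derive x 1 a (a' x)) -> (forall x : R, is_derive x 1 b (b' x)) ->
  continuous a' -> continuous b' -> Ck_strip T 1 (travelling a b).
Proof.
move=> da db ca' cb'.
have cNb' : continuous (fun x => - b' x) by move=> x; apply: cvgN; exact: cb'.
split.
  apply: continuous_subspaceT; apply: travelling_continuous.
    exact: is_derive_continuous da.
  exact: is_derive_continuous db.
have dtE p pS := dtP pS (is_derive_travelling_t p da db).
split.
- move=> p pS; split; first exact: (dtE p pS).1.
  exact: (ex_derive (is_derive := is_derive_travelling_x p da db)).
- apply: (@Ck_strip_ext 0 (travelling a' (fun x => - b' x))).
    by move=> p /set_mem pS; rewrite (dtE p pS).2.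
  by split => //; apply: continuous_subspaceT; exact: travelling_continuous.
- rewrite (dx_travelling da db).
  by split => //; apply: continuous_subspaceT; exact: travelling_continuous.
Qed.

(** The solution is given by d'Alembert's formula. *)
Lemma input_exists (f0 f0' f0'' fT v v' V : R -> R) :
  (forall x : R, is_derive x 1 f0 (f0' x)) ->
  (forall x : R, is_derive x 1 f0' (f0'' x)) -> continuous f0'' ->
  (forall x : R, is_derive x 1 V (v x)) ->
  (forall x : R, is_derive x 1 v (v' x)) -> continuous v' ->
  (forall x, 2 * fT x = f0 (x + T) + f0 (x - T) + (V (x + T) - V (x - T))) ->
  input_space T f0 fT v.
Proof.
move=> df0 ddf0 cf0'' dV dv cv' HT.
pose a (x : R) : R := 2^-1 * (f0 x + V x); pose b (x : R) : R := 2^-1 * (f0 x - V x).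
pose a' (x : R) : R := 2^-1 * (f0' x + v x); pose b' (x : R) : R := 2^-1 * (f0' x - v x).
pose a'' (x : R) : R := 2^-1 * (f0'' x + v' x); pose b'' (x : R) : R := 2^-1 * (f0'' x - v' x).
have da (x : R) : is_derive x 1 a (a' x) by apply: is_derive1Z; exact: is_derive1D.
have db (x : R) : is_derive x 1 b (b' x) by apply: is_derive1Z; exact: is_derive1B.
have dda (x : R) : is_derive x 1 a' (a'' x) by apply: is_derive1Z; exact: is_derive1D.
have ddb (x : R) : is_derive x 1 b' (b'' x) by apply: is_derive1Z; exact: is_derive1B.
have ca'' : continuous a''.
  by move=> x; apply: cvgM; [exact: cvg_cst | apply: (cvgD (cf0'' x) (cv' x))].
have cb'' : continuous b''.
  by move=> x; apply: cvgM; [exact: cvg_cst | apply: (cvgB (cf0'' x) (cv' x))].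
pose Nb' (x : R) : R := - b' x; pose Nb'' (x : R) : R := - b'' x.
have dNb' (x : R) : is_derive x 1 Nb' (Nb'' x) by exact: is_deriveN.
have cNb'' : continuous Nb'' by move=> x; apply: cvgN; exact: cb''.
pose u := travelling a b.
have dtu p (pS : strip T p) := dtP pS (is_derive_travelling_t p da db).
exists u.
  split.
  - have [cu [du _ _]] := travelling_C1 da db
      (is_derive_continuous dda) (is_derive_continuous ddb).
    split=> //; split => //.
    + apply: (@Ck_strip_ext 1 (travelling a' Nb')).
        by move=> p /set_mem pS; rewrite (dtu p pS).2.
      exact: travelling_C1 dda dNb' ca'' cNb''.
    + rewrite (dx_travelling da db); exact: travelling_C1 dda ddb ca'' cb''.
  - move=> p pS.
    have dtuE : {in strip T, dt T u =1 travelling a' Nb'}.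
      by move=> q /set_mem qS; rewrite (dtu q qS).2.
    rewrite {1}/dt (time_quotient_ext dtuE pS) -/(dt T (travelling a' Nb') p).
    rewrite (dtP pS (is_derive_travelling_t p dda dNb')).2.
    rewrite (dx_travelling da db) (dx_travelling dda ddb).
    by rewrite /travelling /Nb'' opprK subrr.
  - by move=> x; rewrite /u /travelling /= subr0 addr0 /a /b; field.
  - move=> x; rewrite /u /travelling /= /a /b.
    by apply: (mulfI (x := 2)) => //; rewrite HT; field.
apply/funext => x; rewrite /input.
have x0 : strip T (0, x) by rewrite /strip/= lexx ltW.
rewrite (dtu _ x0).2 /travelling /= subr0 addr0 /a' /b'; by field.
Qed.

End strip.

(** * Functions with a prescribed increment over a period *)

Section quasi_periodic.
Context {R : realType} (T : R).
Hypothesis T_gt0 : 0 < T.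
Implicit Types (g s v z : R -> R).

(** With s = t_2 and a condition on one integral, this characterizes the
    inputs among the C1 functions. *)
Definition quasi_periodic s v := forall x, v (x + 2 * T) = v x - s x.

(** Total decrement of a quasi-periodic function from x to x + k(2T). *)
Let cumul s (k : int) (x : R) : R := match k with
  | Posz n => \sum_(0 <= i < n) s (x + i%:R * (2 * T))
  | Negz n => - \sum_(0 <= i < n.+1) s (x - i.+1%:R * (2 * T))
  end.

Let cumulS s k x : cumul s (k + 1) x = cumul s k x + s (x + k%:~R * (2 * T)).
Proof.
case: k => [n|[|n]].
- by rewrite -PoszD addn1 /= big_nat_recr.
- by rewrite /= big_nil big_nat1 NegzE mulrNz mulNr addNr.
- have -> : Negz n.+1 + 1 = Negz n :> int by rewrite !NegzE -[n.+2]addn1 PoszD opprD subrK.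
  rewrite /= [in RHS]big_nat_recr//= opprD NegzE mulrNz mulNr.
  by rewrite addrNK.
Qed.

(** A point x is first brought back to [-T, T) by k periods, and the decrement
    accumulated over these k periods is subtracted. *)
Lemma quasi_periodic_extension s g : exists z,
  (forall x, - T <= x < T -> z x = g x) /\ quasi_periodic s z.
Proof.
have T2 : 0 < 2 * T by rewrite mulr_gt0.
pose k x : int := Num.floor ((x + T) / (2 * T)).
pose r x := x - (k x)%:~R * (2 * T).
exists (fun x => g (r x) - cumul s (k x) (r x)); split => x.
- move=> /andP[Tx xT].
  have k0 : k x = 0.
    apply: Num.Theory.floor_def; rewrite add0r ler_pdivlMr// ltr_pdivrMr//.
    by apply/andP; split; lra.
  by rewrite /r k0 mul0r subr0 /= big_nil subr0.
- have kS : k (x + 2 * T) = k x + 1.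
    rewrite /k addrAC mulrDl divff ?gt_eqF//.
    by rewrite Num.Theory.floorDrz ?Num.Theory.floor1// rpred1.
  have rS : r (x + 2 * T) = r x by rewrite /r kS intrD; ring.
  by rewrite kS rS cumulS {3}/r subrK opprD addrA.
Qed.

(** The law propagates continuity by 2T in both directions, so only the points
    of [-T, T) matter; among them only -T, where the value prescribed on the
    left by the law must agree with g(-T). *)
Lemma quasi_periodic_continuous s g z : continuous g -> continuous s ->
  g T = g (- T) - s (- T) ->
  (forall x, - T <= x < T -> z x = g x) -> quasi_periodic s z -> continuous z.
Proof.
move=> cg cs gT zg zs.
have T2 : 0 < 2 * T by rewrite mulr_gt0.
have shift_cont (h : R -> R) (a x : R) : {for x + a, continuous h} ->
    {for x, continuous (fun y => h (y + a))}.
  move=> ch; apply: (@continuous_comp R R R (fun y => y + a) h) => //.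
  by apply: cvgD; [exact: cvg_id | exact: cvg_cst].
have up x : {for x, continuous z} -> {for x + 2 * T, continuous z}.
  move=> cz; have -> : z = (fun y => z (y + - (2 * T)) - s (y + - (2 * T))).
    by apply/funext => y; rewrite -zs subrK.
  by apply: cvgB; apply: shift_cont; rewrite addrK//; exact: cs.
have down x : {for x, continuous z} -> {for x - 2 * T, continuous z}.
  move=> cz; have -> : z = (fun y => z (y + 2 * T) + s y).
    by apply/funext => y; rewrite zs subrK.
  by apply: cvgD; [apply: shift_cont; rewrite subrK | exact: cs].
have base x : - T <= x < T -> {for x, continuous z}.
  move=> /andP[+ xT]; rewrite le_eqVlt => /orP[/eqP <-|Tx].
    apply/cvgrPdist_lt => e e0; rewrite zg ?lexx ?gtrN//.
    have cG : (g (y + 2 * T) + s y) @[y --> - T] --> g (- T).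
      have -> : g (- T) = g (- T + 2 * T) + s (- T).
        by rewrite (_ : - T + 2 * T = T) ?gT ?subrK//; ring.
      by apply: cvgD; [apply: shift_cont; exact: cg | exact: cs].
    have /cvgrPdist_lt /(_ e e0) g1 := cg (- T).
    move/cvgrPdist_lt : cG => /(_ e e0) g2.
    near=> y.
    have [Ty|yT] := leP (- T) y.
      rewrite zg; first by near: y.
      rewrite Ty/=; near: y; apply: cvgr_lt; first exact: cvg_id.
      by rewrite gtrN.
    have -> : z y = g (y + 2 * T) + s y.
      rewrite -zg ?zs ?subrK//.
      apply/andP; split; last by lra.
      have : - 2 * T <= y; last by lra.
      near: y; apply: cvgr_ge; first exact: cvg_id.
      by lra.
    by near: y.
  move=> U; rewrite zg ?(ltW Tx)// => /(cg x).
  have near_x : \forall y \near x, - T < y < T.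
    near=> y; apply/andP; split; near: y.
      exact: cvgr_gt (@cvg_id _ (nbhs x)) _ Tx.
    exact: cvgr_lt (@cvg_id _ (nbhs x)) _ xT.
  apply: filterS2 near_x => y /andP[Ty yT]; rewrite /= zg// yT ltW//.
have nat_shift n r : - T <= r < T ->
    {for r + n%:R * (2 * T), continuous z} /\
    {for r - n%:R * (2 * T), continuous z}.
  move=> rT; elim: n => [|n [/up IHu /down IHd]].
    by rewrite mul0r subr0 addr0; split; exact: base.
  by split; [move: IHu | move: IHd]; congr {for _, continuous z};
    rewrite -natr1; ring.
move=> x; pose k := Num.floor ((x + T) / (2 * T)).
have xk : - T <= x - k%:~R * (2 * T) < T.
  have := Num.Theory.floor_itv ((x + T) / (2 * T)); rewrite -/k.
  rewrite ler_pdivlMr// ltr_pdivrMr// intrD => /andP[? ?].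
  by apply/andP; split; lra.
case: k xk => [n|n] xk.
- by have [+ _] := nat_shift n _ xk; rewrite subrK.
- have [_] := nat_shift n.+1 _ xk.
  by rewrite NegzE mulrNz mulNr opprK addrK.
Unshelve. all: by end_near. Qed.

(** Only the derivative is glued: v is a primitive of the continuous
    quasi-periodic extension v' of g', and the matching of the values of g makes
    the additive constant in v(x + 2T) - v(x) + s(x) vanish. *)
Lemma quasi_periodic_C1 s s' g g' :
  (forall x : R, is_derive x 1 s (s' x)) -> continuous s' ->
  (forall x : R, is_derive x 1 g (g' x)) -> continuous g' ->
  g T = g (- T) - s (- T) -> g' T = g' (- T) - s' (- T) ->
  exists v v', [/\ forall x : R, is_derive x 1 v (v' x), continuous v',
    quasi_periodic s v & forall x, - T <= x <= T -> v x = g x].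
Proof.
move=> ds cs' dg cg' gT g'T.
have [v' [v'g v'qp]] := quasi_periodic_extension s' g'.
have cv' := quasi_periodic_continuous cg' cs' g'T v'g v'qp.
have [V dV] := primitive_exists cv'.
pose v (x : R) : R := V x - V 0 + g 0.
have dv (x : R) : is_derive x 1 v (v' x).
  have := is_derive1D (is_derive1B (dV x) (is_derive_cst (V 0 : R) x 1)) (is_derive_cst (g 0 : R) x 1).
  by move/is_derive_eq; apply; rewrite subr0 addr0.
have vg x : - T <= x <= T -> v x = g x.
  move=> /andP[Tx xT].
  have cst_vg a b : - T <= a -> a <= b -> b <= T -> v b - g b = v a - g a.
    move=> Ta ab bT; apply/eqP; rewrite -subr_eq0.
    have [||c _ ->] := @MVT_segment R (fun y => v y - g y) (fun=> 0) a b ab; last by rewrite mul0r.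
      move=> y; rewrite in_itv/= => /andP[ay yb].
      apply: is_derive_eq (is_derive1B (dv y) (dg y)) _.
      by rewrite v'g ?subrr// (le_trans Ta (ltW ay)) (lt_le_trans yb).
    apply: continuous_subspaceT => y; apply: cvgB.
      exact: (is_derive_continuous dv).
    exact: (is_derive_continuous dg).
  have v0 : v 0 - g 0 = 0 by rewrite /v subrr add0r subrr.
  apply/eqP; rewrite -subr_eq0; apply/eqP; rewrite -v0.
  have [x0|/ltW x0] := leP 0 x; first by apply: cst_vg => //; rewrite oppr_le0 ltW.
  by apply/esym/cst_vg => //; exact: ltW.
exists v, v'; split => // x.
pose e (y : R) : R := v (1 * y + 2 * T) - v y + s y.
have de (y : R) : is_derive y 1 e 0.
  apply: is_derive_eq (is_derive1D (is_derive1B (is_derive1_affine (dv _)) (dv y)) (ds y)) _.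
  by rewrite !mul1r v'qp; ring.
have : e x = e (- T) by exact: is_derive_0_is_cst.
rewrite /e !mul1r (_ : - T + 2 * T = T); last by ring.
have NTT : - T <= T by rewrite (le_trans _ (ltW T_gt0))// oppr_le0 ltW.
by rewrite (vg T) ?NTT ?lexx// (vg (- T)) ?NTT ?lexx// gT => E; lra.
Qed.

End quasi_periodic.

(** * The functions of the minimizer as cumulative increments *)

Section sums_of_translates.
Context {R : realType}.
Implicit Types (f : R -> R).

Lemma is_derive1_sum (I : Type) (r : seq I) (F : I -> R -> R) (F' : I -> R) (x : R) :
  (forall i, is_derive x 1 (F i) (F' i)) ->
  is_derive x 1 (fun y => \sum_(i <- r) F i y) (\sum_(i <- r) F' i).
Proof.
move=> dF; elim: r => [|i r IH].
  rewrite big_nil; under eq_fun do rewrite big_nil.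
  exact: is_derive_cst.
rewrite big_cons; under eq_fun do rewrite big_cons.
exact: is_derive1D.
Qed.

Lemma is_derive1_shift f (x d a : R) : is_derive (x + d) 1 f a ->
  is_derive x 1 (fun y => f (y + d)) a.
Proof.
rewrite -{1}[x]mul1r => /is_derive1_affine; rewrite mul1r.
by under eq_fun do rewrite mul1r.
Qed.

Lemma smooth_derive1 f : smooth f -> smooth (derive1 f).
Proof. by move=> sf n x; have := sf n.+1 x; rewrite derive1Sn. Qed.

Lemma smooth_is_derive f (x : R) : smooth f -> is_derive x 1 f (derive1 f x).
Proof. by move=> sf; rewrite derive1E; apply: derivableP; exact: sf 0 x. Qed.

Variables (T : R) (f0 fT : R -> R).
Hypotheses (smooth_f0 : smooth f0) (smooth_fT : smooth fT).

Let d0 (x : R) := smooth_is_derive x (smooth_derive1 smooth_f0).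
Let dT (x : R) := smooth_is_derive x (smooth_derive1 smooth_fT).

Lemma is_derive_t_right k (x : R) :
  is_derive x 1 (t_right T f0 fT k) (t_right T (derive1 f0) (derive1 fT) k x).
Proof.
apply: is_derive1B; last by apply: is_derive1_shift.
apply: is_derive1B; last by apply: is_derive1Z; apply: is_derive1_sum => i; apply: is_derive1_shift.
apply: is_derive1D => //.
by apply: is_derive1Z; apply: is_derive1_sum => i; apply: is_derive1_shift.
Qed.

Lemma is_derive_t_left k (x : R) :
  is_derive x 1 (t_left T f0 fT k) (t_left T (derive1 f0) (derive1 fT) k x).
Proof.
apply: is_derive1B; last by apply: is_derive1_shift.
apply: is_derive1B; last by apply: is_derive1Z; apply: is_derive1_sum => i; apply: is_derive1_shift.
apply: is_derive1D => //.
by apply: is_derive1Z; apply: is_derive1_sum => i; apply: is_derive1_shift.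
Qed.

Lemma is_derive_t_mean K1 K2 (x : R) :
  is_derive x 1 (t_mean T f0 fT K1 K2) (t_mean T (derive1 f0) (derive1 fT) K1 K2 x).
Proof.
apply: is_derive1Z; apply: is_derive1_sum => i; rewrite /t_fun.
case: ifP => _; first exact: is_derive_cst.
by case: ifP => _; [exact: is_derive_t_right | exact: is_derive_t_left].
Qed.

Lemma t_right0 x : t_right T f0 fT 0 x = 0.
Proof. by rewrite /t_right !big_geq// !mulr0 mul0r !addr0 subr0 subrr. Qed.

Lemma t_left0 x : t_left T f0 fT 0 x = 0.
Proof. by rewrite /t_left !big_geq// !mulr0 mul0r !subr0 addr0 subrr. Qed.

Lemma t_rightS k x : t_right T f0 fT k.+1 x =
  t_right T f0 fT k x + t_right T f0 fT 1 (x + 2 * k%:R * T).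
Proof.
rewrite /t_right !big_nat1 !(big_nat_recl k)//=.
have -> : \sum_(0 <= i < k) derive1 f0 (x + (2 * k.+1%:R - 2 * i.+1%:R) * T) =
    \sum_(0 <= i < k) derive1 f0 (x + (2 * k%:R - 2 * i%:R) * T).
  by apply: eq_bigr => i _; congr (derive1 f0 _); rewrite -[k.+1%:R]natr1 -[i.+1%:R]natr1; ring.
have -> : \sum_(0 <= i < k) derive1 fT (x + (2 * k.+1%:R - 2 * i.+1%:R - 1) * T) =
    \sum_(0 <= i < k) derive1 fT (x + (2 * k%:R - 2 * i%:R - 1) * T).
  by apply: eq_bigr => i _; congr (derive1 fT _); rewrite -[k.+1%:R]natr1 -[i.+1%:R]natr1; ring.
rewrite -[k.+1%:R]natr1 (_ : x + 2 * k%:R * T + (2 * 1 - 2 * 0) * T = x + (2 * (k%:R + 1) - 2 * 0) * T);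
  last by ring.
rewrite (_ : x + 2 * k%:R * T + (2 * 1 - 2 * 0 - 1) * T = x + (2 * (k%:R + 1) - 2 * 0 - 1) * T);
  last by ring.
rewrite (_ : x + 2 * k%:R * T + 2 * 1 * T = x + 2 * (k%:R + 1) * T); last by ring.
by ring.
Qed.

Lemma t_leftS k x : t_left T f0 fT k.+1 x =
  t_left T f0 fT k x - t_right T f0 fT 1 (x - 2 * k.+1%:R * T).
Proof.
rewrite /t_left /t_right !big_nat1 !(big_nat_recl k)//=.
have -> : \sum_(0 <= i < k) derive1 fT (x + (2 * i.+1%:R + 1 - 2 * k.+1%:R) * T) =
    \sum_(0 <= i < k) derive1 fT (x + (2 * i%:R + 1 - 2 * k%:R) * T).
  by apply: eq_bigr => i _; congr (derive1 fT _); rewrite -[k.+1%:R]natr1 -[i.+1%:R]natr1; ring.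
have -> : \sum_(0 <= i < k) derive1 f0 (x + 2 * (i.+1%:R + 1 - k.+1%:R) * T) =
    \sum_(0 <= i < k) derive1 f0 (x + 2 * (i%:R + 1 - k%:R) * T).
  by apply: eq_bigr => i _; congr (derive1 f0 _); rewrite -[k.+1%:R]natr1 -[i.+1%:R]natr1; ring.
rewrite -[k.+1%:R]natr1 (_ : x - 2 * (k%:R + 1) * T + (2 * 1 - 2 * 0) * T = x - 2 * k%:R * T);
  last by ring.
rewrite (_ : x - 2 * (k%:R + 1) * T + (2 * 1 - 2 * 0 - 1) * T = x + (2 * 0 + 1 - 2 * (k%:R + 1)) * T);
  last by ring.
rewrite (_ : x - 2 * (k%:R + 1) * T + 2 * 1 * T = x - 2 * k%:R * T); last by ring.
rewrite (_ : x + 2 * (0 + 1 - (k%:R + 1)) * T = x - 2 * k%:R * T); last by ring.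
by ring.
Qed.

(** So [t_right] and [t_left] are the decrements of an input over k periods to
    the right and to the left. *)
Lemma quasi_periodic_right v k x : quasi_periodic T (t_right T f0 fT 1) v ->
  v (x + 2 * k%:R * T) = v x - t_right T f0 fT k x.
Proof.
move=> vs; elim: k => [|k IH]; first by rewrite t_right0 mulr0 mul0r addr0 subr0.
rewrite t_rightS opprD addrA -IH -vs; congr v.
by rewrite -natr1; ring.
Qed.

Lemma quasi_periodic_left v k x : quasi_periodic T (t_right T f0 fT 1) v ->
  v (x - 2 * k%:R * T) = v x - t_left T f0 fT k x.
Proof.
move=> vs; elim: k => [|k IH]; first by rewrite t_left0 mulr0 mul0r !subr0.
rewrite t_leftS opprB addrCA addrC -IH.
have -> : v (x - 2 * k%:R * T) = v (x - 2 * k.+1%:R * T + 2 * T).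
  by congr v; rewrite -natr1; ring.
by rewrite vs subrK.
Qed.

End sums_of_translates.

(** * Characterization of the inputs *)

Section input_space.
Context {R : realType} (T : R) (f0 fT : R -> R).
Hypotheses (T_gt0 : 0 < T) (smooth_f0 : smooth f0) (smooth_fT : smooth fT).
Notation mu := (@lebesgue_measure R).

Let NT_lt_T : - T < T. Proof. by rewrite gtrN. Qed.

Let t_right1 x : t_right T f0 fT 1 x =
  derive1 f0 x + derive1 f0 (x + 2 * T) - 2 * derive1 fT (x + T).
Proof.
rewrite /t_right !big_nat1 (_ : (2 * 1 - 2 * 0) * T = 2 * T); last by ring.
by rewrite (_ : (2 * 1 - 2 * 0 - 1) * T = T) ?mulr1; ring.
Qed.

(** The derivative of the defect in d'Alembert's formula is the defect in the
    quasi-periodicity of v. *)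
Let is_derive_dAlembert v V (x : R) : (forall x : R, is_derive x 1 V (v x)) ->
  is_derive x 1
    (fun x => f0 (x + T) + f0 (x - T) + (V (x + T) - V (x - T)) - 2 * fT x)
    (v (x + T) - (v (x - T) - t_right T f0 fT 1 (x - T))).
Proof.
move=> dV; have d0 y := smooth_is_derive y smooth_f0.
have dT y := smooth_is_derive y smooth_fT.
have := is_derive1B (is_derive1D
    (is_derive1D (is_derive1_shift (d0 (x + T))) (is_derive1_shift (d0 (x - T))))
    (is_derive1B (is_derive1_shift (dV (x + T))) (is_derive1_shift (dV (x - T)))))
  (is_derive1Z 2 (dT x)).
move/is_derive_eq; apply.
by rewrite t_right1 (_ : x - T + 2 * T = x + T) ?subrK; ring.
Qed.

Lemma input_space_quasi_periodic v : input_space T f0 fT v ->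
  [/\ continuous v, quasi_periodic T (t_right T f0 fT 1) v &
      \int[mu]_(x in `[- T, T]) v x = constA T f0 fT].
Proof.
move=> [u u_sol ->] {v}; set v := input T u.
have cv : continuous v := input_continuous T_gt0 u_sol.
have [V dV] := primitive_exists cv.
have H := solution_dAlembert T_gt0 u_sol (fun x => smooth_is_derive x smooth_f0) dV.
split => // [y|].
- have := is_derive_dAlembert (y + T) dV.
  rewrite (_ : (fun x => _) = cst 0); last first.
    by apply/funext => x; rewrite H subrr.
  move=> dPhi; have := derive_val (is_derive := dPhi).
  rewrite derive_cst addrK (_ : y + T + T = y + 2 * T); last by ring.
  by move/eqP; rewrite eq_sym subr_eq0 => /eqP.
- rewrite (Rintegral_FTC NT_lt_T cv dV) /constA H !add0r; ring.
Qed.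

Lemma quasi_periodic_input_space v v' :
  (forall x : R, is_derive x 1 v (v' x)) -> continuous v' ->
  quasi_periodic T (t_right T f0 fT 1) v ->
  \int[mu]_(x in `[- T, T]) v x = constA T f0 fT -> input_space T f0 fT v.
Proof.
move=> dv cv' vqp vA.
have cv : continuous v := is_derive_continuous dv.
have [V dV] := primitive_exists cv.
have d0 y := smooth_is_derive y smooth_f0.
have dd0 y := smooth_is_derive y (smooth_derive1 smooth_f0).
have cd0 : continuous (derive1 (derive1 f0)).
  apply: is_derive_continuous => x.
  exact: smooth_is_derive (smooth_derive1 (smooth_derive1 smooth_f0)).
apply: (input_exists T_gt0 d0 dd0 cd0 dV dv cv') => x.
pose Phi x := f0 (x + T) + f0 (x - T) + (V (x + T) - V (x - T)) - 2 * fT x.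
have dPhi (y : R) : is_derive y 1 Phi 0.
  have := is_derive_dAlembert y dV; move/is_derive_eq; apply.
  by rewrite -vqp (_ : y - T + 2 * T = y + T) ?subrr//; ring.
have PhiE : Phi x = Phi 0 by exact: is_derive_0_is_cst.
have Phi0 : Phi 0 = 0.
  have := vA; rewrite (Rintegral_FTC NT_lt_T cv dV) /constA /Phi !add0r; lra.
by apply/eqP; rewrite eq_sym -subr_eq0 -/(Phi x) PhiE Phi0.
Qed.

End input_space.

(** * Correction of the boundary values at a small L2 cost *)

Section correction.
Context {R : realType} (T : R).
Hypothesis T_gt0 : 0 < T.
Notation mu := (@lebesgue_measure R).

Let NT_lt_T : - T < T. Proof. by rewrite gtrN. Qed.

Let P k (x : R) : R := (x / T) ^+ k.

Let PT k : P k T = 1. Proof. by rewrite /P divff ?expr1n// gt_eqF. Qed.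

Let PNT k : P k (- T) = (-1) ^+ k.
Proof. by rewrite /P mulNr divff// gt_eqF. Qed.

Let dP k (x : R) : is_derive x 1 (P k.+1) (k.+1%:R / T * P k x).
Proof.
have := @is_deriveX R R (fun y => T^-1 * y) k.+1 x 1 _
  (is_derive1Z T^-1 (is_derive_id x (1 : R))).
rewrite (_ : (fun y => T^-1 * y) ^+ k.+1 = P k.+1).
  by move/is_derive_eq; apply; rewrite /= /P [x / T]mulrC /GRing.scale/=; ring.
by apply/funext => y; rewrite /P [y / T]mulrC exprfctE.
Qed.

(** The type class search uses this to differentiate the primitives below. *)
Let dPrim k (x : R) : is_derive x 1 (fun y => T / k.+1%:R * P k.+1 y) (P k x).
Proof.
have T0 : T != 0 by rewrite gt_eqF.
apply: is_derive_eq (is_derive1Z _ (dP k x)) _.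
by field; rewrite T0 nat1r pnatr_eq0.
Qed.

Let cP k : continuous (P k).
Proof.
move=> x; apply: (@continuous_comp R R R (fun y => y / T) (fun y => y ^+ k)).
  by apply: cvgM; [exact: cvg_id | exact: cvg_cst].
exact: exprn_continuous.
Qed.

(** High powers of x/T have jumps of order 1 between the endpoints but small L2
    norm.  An odd power takes care of the value; an even power, scaled by the
    inverse of its exponent, takes care of the derivative, and subtracting its
    mean keeps the integral equal to 0. *)
Lemma small_correction (alpha beta e : R) : 0 < e -> exists c c' : R -> R,
  [/\ forall x : R, is_derive x 1 c (c' x), continuous c',
      c T - c (- T) = alpha /\ c' T - c' (- T) = beta,
      \int[mu]_(x in `[- T, T]) c x = 0 &
      \int[mu]_(x in `[- T, T]) (c x ^+ 2) < e].
Proof.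
move=> e0; have T0 : T != 0 by rewrite gt_eqF.
pose B := alpha ^+ 2 * T + beta ^+ 2 * T ^+ 3.
pose n := Num.truncn (B / e).
have [N NE] : exists N : R, N = n.+1%:R by exists n.+1%:R.
have N0 : 0 < N by rewrite NE ltr0n.
have N_neq0 : N != 0 by rewrite gt_eqF.
have BN : B / N < e.
  by rewrite ltr_pdivrMr// mulrC -ltr_pdivrMr// NE; exact: Num.Theory.truncnS_gt.
(* The exponents are m + 1 = 2n + 1 and m + 2 = 2N. *)
pose m := n.*2.
have mN : m.+2%:R = 2 * N by rewrite /m -doubleS -muln2 natrM NE mulrC.
have mN1 : m.+3%:R = 2 * N + 1 by rewrite -natr1 mN.
have oddP k : odd k -> P k (- T) = -1 by move=> ok; rewrite PNT -signr_odd ok.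
have evenP k : ~~ odd k -> P k (- T) = 1.
  by move=> ok; rewrite PNT -signr_odd (negbTE ok).
have om1 : odd m.+1 by rewrite /= odd_double.
have em2 : ~~ odd m.+2 by rewrite /= odd_double.
have om3 : odd m.+3 by rewrite /= odd_double.
have em : ~~ odd m by rewrite odd_double.
pose g := beta * T / (4 * N).
pose c x := alpha / 2 * P m.+1 x + g * (P m.+2 x - m.+3%:R^-1).
pose c' x := alpha / 2 * (m.+1%:R / T * P m x) + g * (m.+2%:R / T * P m.+1 x).
have dc (x : R) : is_derive x 1 c (c' x).
  apply: is_derive1D; first exact: is_derive1Z.
  apply: is_derive1Z; rewrite -[X in is_derive _ _ _ X]subr0.
  by apply: is_derive1B => //; exact: is_derive_cst.
have cc : continuous c := is_derive_continuous dc.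
have cc' : continuous c'.
  move=> x; apply: cvgD; (apply: cvgM; first exact: cvg_cst);
    by apply: cvgM; [exact: cvg_cst | exact: cP].
exists c, c'; split => //.
- rewrite /c /c' !PT (oddP _ om1) (evenP _ em2) (evenP _ em); split; first by field.
  by rewrite mN /g; field; rewrite T0 N_neq0.
- pose C x := alpha / 2 * (T / m.+2%:R * P m.+2 x) +
    g * (T / m.+3%:R * P m.+3 x - m.+3%:R^-1 * x).
  have dC (x : R) : is_derive x 1 C (c x).
    apply: is_derive1D; apply: is_derive1Z => //; apply: is_derive1B => //.
    by rewrite -[X in is_derive _ _ _ X]mulr1; exact: is_derive1Z.
  rewrite (Rintegral_FTC NT_lt_T cc dC) /C !PT. rewrite (evenP _ em2) (oddP _ om3) mN mN1.
  by field; rewrite N_neq0 gt_eqF//; lra.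
have sqr_sub_le1 (p q : R) : 0 <= p -> p <= 1 -> 0 <= q -> q <= 1 ->
    (p - q) ^+ 2 <= 1 by move=> *; nra.
have sqr_add_le (p q : R) : (p + q) ^+ 2 <= 2 * p ^+ 2 + 2 * q ^+ 2.
  by have := sqr_ge0 (p - q); lra.
(* b bounds c ^+ 2 on [-T, T], as 0 <= P (m + 2) x <= 1 there. *)
pose b x := alpha ^+ 2 / 2 * P (m.+1).*2 x + 2 * g ^+ 2.
pose Bd x := alpha ^+ 2 / 2 * (T / (m.+1).*2.+1%:R * P (m.+1).*2.+1 x) + 2 * g ^+ 2 * x.
have dBd (x : R) : is_derive x 1 Bd (b x).
  apply: is_derive1D; first exact: is_derive1Z.
  by rewrite -[X in is_derive _ _ _ X]mulr1; exact: is_derive1Z.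
have cb : continuous b.
  move=> x; apply: cvgD; last exact: cvg_cst.
  by apply: cvgM; [exact: cvg_cst | exact: cP].
have cc2 : continuous (fun x => c x ^+ 2) by move=> x; apply: cvgM; exact: cc.
apply: (@le_lt_trans _ _ (\int[mu]_(x in `[- T, T]) b x)).
  apply: le_Rintegral => //; [exact: integrable_itv..|].
  move=> x /=; rewrite in_itv/= => /andP[Tx xT].
  have xT1 : `|x / T| <= 1.
    by rewrite normrM normfV [`|T|]gtr0_norm// ler_pdivrMr// mul1r ler_norml Tx.
  have P2 : 0 <= P m.+2 x <= 1.
    have -> : P m.+2 x = `|P m.+2 x|.
      by rewrite ger0_norm// /P exprn_even_ge0//= odd_double.
    by rewrite normr_ge0 /P normrX exprn_ile1.
  have i0 : 0 <= m.+3%:R^-1 :> R by rewrite invr_ge0 ler0n.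
  have i1 : m.+3%:R^-1 <= 1 :> R by rewrite invf_le1 ?ler1n// ltr0n.
  have -> : b x = 2 * (alpha / 2 * P m.+1 x) ^+ 2 + 2 * g ^+ 2.
    by rewrite /b /P -muln2 exprM; field.
  have : (g * (P m.+2 x - m.+3%:R^-1)) ^+ 2 <= g ^+ 2.
    rewrite exprMn ler_piMr ?sqr_ge0//.
    case/andP: P2 => P0 P1.
    exact: sqr_sub_le1.
  move=> A2; rewrite /c; apply: le_trans (sqr_add_le _ _) _.
  by rewrite lerD2l ler_wpM2l.
rewrite (Rintegral_FTC NT_lt_T cb dBd) /Bd PT oddP; last by rewrite oddS odd_double.
apply: le_lt_trans BN.
have N1 : 1 <= N by rewrite NE ler1n.
have -> : (m.+1).*2.+1%:R = 4 * N - 1 :> R.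
  by rewrite -natr1 -muln2 natrM -[m.+1%:R](addrK 1) natr1 mN; ring.
have N4 : 0 < 4 * N - 1 by lra.
have -> : alpha ^+ 2 / 2 * (T / (4 * N - 1) * 1) + 2 * g ^+ 2 * T -
    (alpha ^+ 2 / 2 * (T / (4 * N - 1) * -1) + 2 * g ^+ 2 * - T) =
    alpha ^+ 2 * T / (4 * N - 1) + beta ^+ 2 * T ^+ 3 / (4 * N ^+ 2).
  by rewrite /g; field; rewrite N_neq0 gt_eqF.
rewrite /B [leRHS]mulrDl; apply: lerD.
  apply: ler_wpM2l; first by rewrite mulr_ge0 ?sqr_ge0 ?ltW.
  by rewrite lef_pV2 ?posrE//; lra.
apply: ler_wpM2l; first by rewrite mulr_ge0 ?sqr_ge0 ?exprn_ge0 ?ltW.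
by rewrite lef_pV2 ?posrE ?mulr_gt0 ?exprn_gt0//; nra.
Qed.

End correction.

(** * Inputs approximating a given function on one period *)

Section approximation.
Context {R : realType} (T : R) (f0 fT : R -> R).
Hypotheses (T_gt0 : 0 < T) (smooth_f0 : smooth f0) (smooth_fT : smooth fT).
Notation mu := (@lebesgue_measure R).

Lemma t_right_continuous k : continuous (t_right T f0 fT k).
Proof. exact: is_derive_continuous (is_derive_t_right T smooth_f0 smooth_fT k). Qed.

Lemma t_left_continuous k : continuous (t_left T f0 fT k).
Proof. exact: is_derive_continuous (is_derive_t_left T smooth_f0 smooth_fT k). Qed.

Lemma input_space_approximation g g' e :
  (forall x : R, is_derive x 1 g (g' x)) -> continuous g' ->
  \int[mu]_(x in `[- T, T]) g x = constA T f0 fT -> 0 < e ->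
  exists v, input_space T f0 fT v /\
    \int[mu]_(x in `[- T, T]) (v x - g x) ^+ 2 < e.
Proof.
move=> dg cg' gA e0.
pose s := t_right T f0 fT 1.
pose s' := t_right T (derive1 f0) (derive1 fT) 1.
have ds (x : R) : is_derive x 1 s (s' x) := is_derive_t_right T smooth_f0 smooth_fT 1 x.
have cs' : continuous s'.
  exact: is_derive_continuous
    (is_derive_t_right T (smooth_derive1 smooth_f0) (smooth_derive1 smooth_fT) 1).
have [c [c' [dc cc' [cT c'T] c0 ce]]] := small_correction T_gt0
  (g (- T) - s (- T) - g T) (g' (- T) - s' (- T) - g' T) e0.
have cg : continuous g := is_derive_continuous dg.
have cc : continuous c := is_derive_continuous dc.
have dh (x : R) : is_derive x 1 (fun y => g y + c y) (g' x + c' x).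
  exact: is_derive1D.
have ch' : continuous (fun x => g' x + c' x).
  by move=> x; apply: cvgD; [exact: cg' | exact: cc'].
have [||v [v' [dv cv' vqp vh]]] := quasi_periodic_C1 T_gt0 ds cs' dh ch'.
- by lra.
- by lra.
exists v; split.
  apply: (quasi_periodic_input_space T_gt0 smooth_f0 smooth_fT dv cv' vqp).
  rewrite -gA -[RHS]addr0 -c0 -RintegralD//; [|exact: integrable_itv..].
  by apply: eq_Rintegral => x; rewrite inE/= in_itv/= => /vh.
rewrite (_ : (\int[mu]_(x in _) _) = \int[mu]_(x in `[- T, T]) (c x ^+ 2))//.
apply: eq_Rintegral => x; rewrite inE/= in_itv/= => /vh ->.
by rewrite addrAC subrr add0r.
Qed.

End approximation.

(** * Integrals over consecutive translates of an interval *)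

Section piecewise_continuous.
Context {R : realType}.
Notation mu := (@lebesgue_measure R).
Implicit Types (F : R -> R) (G : nat -> R -> R).

Lemma Rintegral_translate (g : R -> R) (a b d : R) : a < b -> continuous g ->
  \int[mu]_(x in `[a + d, b + d]) g (x - d) = \int[mu]_(x in `[a, b]) g x.
Proof.
move=> ab cg; have [P dP] := primitive_exists cg.
rewrite (Rintegral_FTC ab cg dP).
have cgd : continuous (fun x => g (x - d)).
  move=> x; apply: (@continuous_comp R R R (fun x => x - d) g); last exact: cg.
  by apply: cvgB; [exact: cvg_id | exact: cvg_cst].
have dPd (x : R) : is_derive x 1 (fun x => P (x - d)) (g (x - d)).
  exact: is_derive1_shift.
have abd : a + d < b + d by rewrite ltrD2r.
by rewrite (Rintegral_FTC abd cgd dPd) !addrK.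
Qed.

Let pieces_co (a c L : R) (n : nat) F G : 0 < L ->
  (forall i, continuous (G i)) ->
  (forall i x, (i < n)%N -> a <= x < a + L -> F (x + (c + i%:R * L)) = G i x) ->
  mu.-integrable `[a + c, a + c + n%:R * L[ (EFin \o F) /\
  \int[mu]_(x in `[a + c, a + c + n%:R * L[) F x =
    \sum_(i < n) \int[mu]_(x in `[a, a + L]) G i x.
Proof.
move=> L0 cG; elim: n => [|n IH] FG.
  rewrite mul0r addr0 set_itvco0 big_ord0 Rintegral_set0.
  by split => //; exact: integrable_set0.
have [int_n IHn] := IH (fun i x iltn => FG i x (ltnW iltn)).
set b := a + c + n%:R * L in int_n IHn *.
have -> : a + c + n.+1%:R * L = b + L by rewrite -natr1 /b; ring.
pose d := c + n%:R * L.
have bE : b = a + d by rewrite /b /d addrA.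
pose H x := G n (x - d).
have cH : continuous H.
  move=> x; apply: (@continuous_comp R R R (fun x => x - d) (G n)); last exact: cG.
  by apply: cvgB; [exact: cvg_id | exact: cvg_cst].
have FH : {in `[b, (b + L)[%classic, H =1 F}.
  move=> x; rewrite inE/= in_itv/= => /andP[bx xb].
  rewrite /H -FG ?subrK// lerBrDr -bE bx ltrBlDr; move: xb; rewrite bE; lra.
have int_H : mu.-integrable `[b, (b + L)[ (EFin \o H).
  by apply: integrableS (integrable_itv b (b + L) cH) => //; exact: subset_itv_co_cc.
have int_F : mu.-integrable `[b, (b + L)[ (EFin \o F).
  by apply: eq_integrable int_H => // x xb; rewrite /= FH.
have Lb : b <= b + L by rewrite lerDl ltW.
have ab : a + c <= b by rewrite lerDl mulr_ge0// ltW.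
have U : `[a + c, (b + L)[%classic = `[a + c, b[%classic `|` `[b, (b + L)[%classic.
  by rewrite -itv_bndbnd_setU ?bnd_simp.
have disj : [disjoint `[a + c, b[%classic & `[b, (b + L)[%classic].
  apply/disj_setPS => y [/=]; rewrite !in_itv/= => /andP[_ yb] /andP[].
  by rewrite leNgt yb.
have mF := (measurable_funU _ (measurable_itv _) (measurable_itv _)).2
  (conj (measurable_int _ int_n) (measurable_int _ int_F)).
have int_U : mu.-integrable (`[a + c, b[ `|` `[b, (b + L)[)%classic (EFin \o F).
  apply/integrableP; split => //.
  rewrite ge0_integral_setU//; first last.
    exact: ((measurable_funU _ (measurable_itv _) (measurable_itv _)).2
      (conj (measurable_int _ (integrable_abse int_n))
            (measurable_int _ (integrable_abse int_F)))).
  by rewrite lte_add_pinfty//; [case/integrableP: int_n | case/integrableP: int_F].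
rewrite U; split => //.
rewrite Rintegral_setU// IHn big_ord_recr/=; congr (_ + _).
rewrite -(@eq_Rintegral _ _ _ mu _ _ _ FH) Rintegral_itv_bndo_bndc//.
have -> : b + L = a + L + d by rewrite bE; ring.
by rewrite bE Rintegral_translate// ltrDl.
Qed.

(** F may jump at the endpoints of the pieces, as the extension of v* does. *)
Lemma Rintegral_pieces (a c L : R) (n : nat) F G : 0 < L ->
  (forall i, continuous (G i)) ->
  (forall i x, (i < n)%N -> a <= x < a + L -> F (x + (c + i%:R * L)) = G i x) ->
  mu.-integrable `[a + c, a + c + n%:R * L] (EFin \o F) /\
  \int[mu]_(x in `[a + c, a + c + n%:R * L]) F x =
    \sum_(i < n) \int[mu]_(x in `[a, a + L]) G i x.
Proof.
move=> L0 cG FG; have [/[dup] intF /integrableP[mF Foo] FE] := pieces_co L0 cG FG.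
split; last by rewrite -Rintegral_itv_bndo_bndc.
apply/integrableP; split; first exact/emeasurable_fun_itv_bndo_bndcP.
by rewrite -integral_itv_bndo_bndc//; exact: (measurable_int _ (integrable_abse intF)).
Qed.

End piecewise_continuous.

(** * The L2 norm on a measurable set *)

Section L2_norm.
Context {R : realType} (D : set R).
Hypothesis mD : measurable D.
Notation mu := (@lebesgue_measure R).
Implicit Types f g : R -> R.

Let measurable_on f := measurable_fun setT (f \_ D).

Lemma L2_measurable f : L2 D f -> measurable_on f.
Proof. by rewrite /L2 inE => /andP[]; rewrite inE. Qed.

Lemma measurable_onB f g : measurable_on f -> measurable_on g ->
  measurable_on (f \- g).
Proof.
move=> mf mg; rewrite /measurable_on.
have -> : (f \- g) \_ D = f \_ D \- g \_ D.
  by apply/funext => x; rewrite /= !patchE; case: ifPn => _ //=; rewrite subr0.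
exact: measurable_funB.
Qed.

Lemma L2norm_triangle f g : measurable_on f -> measurable_on g ->
  (L2norm D f <= L2norm D g + L2norm D (f \- g)%R)%E.
Proof.
move=> mf mg; rewrite /L2norm.
have -> : f \_ D = g \_ D \+ (f \- g) \_ D.
  apply/funext => x; rewrite /= !patchE; case: ifPn => _ /=; last by rewrite addr0.
  by rewrite addrC subrK.
apply: minkowski_EFin => //; last by rewrite ler1n.
exact: measurable_onB.
Qed.

Lemma L2normBC f g : L2norm D (f \- g) = L2norm D (g \- f).
Proof.
rewrite /L2norm -oppe_Lnorm; apply: eq_Lnorm => x /=.
rewrite !patchE; case: ifPn => _ /=; last by rewrite [point]/(0 : R) oppr0.
by rewrite opprB.
Qed.

Lemma L2normE f : mu.-integrable D (EFin \o (fun x => f x ^+ 2)) ->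
  L2norm D f = (Num.sqrt (\int[mu]_(x in D) (f x ^+ 2)))%:E.
Proof.
move=> intf; rewrite /L2norm unlock /Lnorm.
have -> : (\int[mu]_x `|(EFin \o f \_ D) x| `^ 2 = (\int[mu]_(x in D) (f x ^+ 2))%:E)%E.
  rewrite /Rintegral fineK; last exact: integrable_fin_num.
  rewrite [RHS]integral_mkcond; apply: eq_integral => x _ /=.
  rewrite !patchE; case: ifPn => _ /=.
    by rewrite powR_mulrn// real_normK// num_real.
  by rewrite normr0 powR0// pnatr_eq0.
rewrite poweR_EFin powR12_sqrt//.
by apply: Rintegral_ge0 => x _; exact: sqr_ge0.
Qed.

(** Reduces convergence in the extended reals to an epsilon condition. *)
Lemma L2cvgP (v_ : nat -> R -> R) w : L2cvg D v_ w <->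
  forall e, 0 < e -> \forall n \near \oo, (L2norm D (v_ n \- w)%R < e%:E)%E.
Proof.
have lt_fine n e : (L2norm D (v_ n \- w)%R < e%:E)%E =
    (L2norm D (v_ n \- w)%R \is a fin_num) &&
    (`|0 - fine (L2norm D (v_ n \- w)%R)| < e).
  have := Lnorm_ge0 mu 2%:E (EFin \o (v_ n \- w)%R \_ D); rewrite -/(L2norm D _).
  case: (L2norm D _) => [x|//|//]; rewrite lee_fin lte_fin /= => x0.
  by rewrite sub0r normrN ger0_norm.
split=> [/fine_cvgP[fin /cvgrPdist_lt dist] e e0|lt_e].
  by apply: filterS2 fin (dist e e0) => n fin_n dist_n; rewrite lt_fine fin_n.
apply/fine_cvgP; split.
  by apply: filterS (lt_e 1 ltr01) => n; rewrite lt_fine => /andP[].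
apply/cvgrPdist_lt => e e0.
by apply: filterS (lt_e e e0) => n; rewrite lt_fine => /andP[].
Qed.

Lemma L2_of_integrable_sqr f : measurable_fun D f ->
  mu.-integrable D (EFin \o (fun x => f x ^+ 2)) -> L2 D f.
Proof.
move=> mf intf; rewrite /L2 inE; apply/andP; split; rewrite inE/=.
  exact: (measurable_restrictT f mD).1.
by rewrite /finite_norm -/(L2norm D f) L2normE// ltry.
Qed.

Lemma L2norm_eq0 f : measurable_on f -> L2norm D f = 0%E ->
  {ae mu, forall x, D x -> f x = 0}.
Proof.
move=> mf f0; have : EFin \o f \_ D = \0 %[ae mu].
  apply: Lnorm_eq0_eq0 f0; last by rewrite lte_fin.
  exact/measurable_EFinP.
apply: filterS; first exact: (ae_filter_ringOfSetsType mu).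
move=> x /(_ I) /= [] fx0 Dx.
by rewrite -fx0 patchE mem_set.
Qed.

End L2_norm.

(** * Minimizing sequences under a Pythagorean identity *)

Section minimization.
Context {R : realType} (D : set R) (S : set (R -> R)) (m : R -> R) (r : R).
Hypotheses (r_ge0 : 0 <= r) (m_L2 : L2 D m)
  (S_measurable : forall v, S v -> measurable_fun setT (v \_ D))
  (m_norm : L2norm D m = r%:E)
  (pythagoras : forall v, S v -> exists d, [/\ 0 <= d,
     L2norm D (v \- m) = d%:E & L2norm D v = (Num.sqrt (r ^+ 2 + d ^+ 2))%:E])
  (approximable : forall e, 0 < e -> exists2 v, S v & (L2norm D (v \- m)%R < e%:E)%E).
Notation mu := (@lebesgue_measure R).

Lemma ereal_inf_L2norm : ereal_inf [set L2norm D v | v in S] = L2norm D m.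
Proof.
apply/eqP; rewrite eq_le; apply/andP; split; last first.
  apply/ereal_infP => _ [v Sv <-].
  have [d [d0 _ ->]] := pythagoras Sv.
  by rewrite m_norm lee_fin -[leLHS]ger0_norm// -sqrtr_sqr ler_wsqrtr// lerDl sqr_ge0.
rewrite m_norm; apply/lee_addgt0Pr => e e0.
have [v Sv ve] := approximable e0.
apply: ge_ereal_inf; exists (L2norm D v); first by exists v.
apply: le_trans (L2norm_triangle (S_measurable Sv) (L2_measurable m_L2)) _.
by rewrite m_norm leeD2l// ltW.
Qed.

Lemma approximating_sequence : exists v_ : nat -> R -> R,
  (forall n, S (v_ n)) /\ L2cvg D v_ m.
Proof.
have /choice[v_ v_P] : forall n : nat, exists v, S v /\
    (L2norm D (v \- m)%R < (n.+1%:R^-1)%:E)%E.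
  move=> n; have [|v Sv ve] := @approximable n.+1%:R^-1; first by rewrite invr_gt0.
  by exists v.
exists v_; split => [n|]; first exact: (v_P n).1.
apply/L2cvgP => e e0.
have /cvgrPdist_lt /(_ e e0) := @cvg_harmonic R.
apply: filterS => n; rewrite sub0r normrN ger0_norm ?invr_ge0// => ne.
by apply: lt_trans (v_P n).2 _; rewrite lte_fin.
Qed.

(** By Pythagoras, d^2 = |v_n|^2 - r^2, and |v_n| <= r + h once v_n is h-close
    to w; then d^2 <= 2 r h + h^2. *)
Lemma minimizing_cvg (v_ : nat -> R -> R) (w : R -> R) : (forall n, S (v_ n)) ->
  L2 D w -> L2norm D w = r%:E -> L2cvg D v_ w -> L2cvg D v_ m.
Proof.
move=> Sv w_L2 w_norm /L2cvgP vw; apply/L2cvgP => e e0.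
(* h <= 1 gives 2 r h + h^2 <= (2 r + 1) h <= e^2. *)
pose h := Num.min 1 (e ^+ 2 / (2 * r + 1)).
have r1 : 0 < 2 * r + 1 by rewrite ltr_wpDl// mulr_ge0.
have h0 : 0 < h by rewrite lt_min ltr01 divr_gt0// exprn_gt0.
apply: filterS (vw h h0) => n vn_h.
have [d [d0 -> vn]] := pythagoras (Sv n).
have : ((Num.sqrt (r ^+ 2 + d ^+ 2))%:E < (r + h)%:E)%E.
  rewrite -vn EFinD -w_norm.
  apply: le_lt_trans (L2norm_triangle (S_measurable (Sv n)) (L2_measurable w_L2)) _.
  by rewrite w_norm lteD2lE.
rewrite !lte_fin -ltr_sqr ?nnegrE ?sqrtr_ge0 ?addr_ge0 ?(ltW h0)//.
rewrite sqr_sqrtr ?addr_ge0 ?sqr_ge0// => dh.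
have h1 : h <= 1 by rewrite ge_min lexx.
have he : h * (2 * r + 1) <= e ^+ 2 by rewrite -ler_pdivlMr// ge_min lexx orbT.
rewrite -ltr_sqr ?nnegrE ?(ltW e0)//; apply: lt_le_trans he.
have : h ^+ 2 <= h by rewrite expr2 ger_pMr.
move: dh; rewrite sqrrD; lra.
Qed.

Lemma minimizing_limit (v_ : nat -> R -> R) (w w' : R -> R) : (forall n, S (v_ n)) ->
  L2 D w -> L2norm D w = r%:E -> L2cvg D v_ w ->
  L2 D w' -> L2cvg D v_ w' -> {ae mu, forall x, D x -> w' x = m x}.
Proof.
move=> Sv w_L2 w_norm vw w'_L2 /L2cvgP vw'.
have /L2cvgP vm := minimizing_cvg Sv w_L2 w_norm vw.
have mw' := L2_measurable w'_L2; have mm := L2_measurable m_L2.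
have mw'm : measurable_fun setT ((w' \- m) \_ D).
  exact: measurable_onB.
have : L2norm D (w' \- m) = 0%E.
  apply/eqP; rewrite eq_le Lnorm_ge0 andbT; apply/lee_addgt0Pr => e e0.
  rewrite add0e.
  have e2 : 0 < e / 2 by rewrite divr_gt0.
  have [n [vn vn']] : exists n, (L2norm D (v_ n \- m)%R < (e / 2)%:E)%E /\
      (L2norm D (v_ n \- w')%R < (e / 2)%:E)%E.
    by have [n _ /(_ n (leqnn n))] := filterI (vm _ e2) (vw' _ e2); exists n.
  have mvm : measurable_fun setT ((v_ n \- m) \_ D).
    by apply: measurable_onB => //; exact: S_measurable.
  apply: le_trans (L2norm_triangle mw'm mvm) _.
  rewrite (_ : (w' \- m) \- (v_ n \- m) = w' \- v_ n); last first.
    by apply/funext => x /=; ring.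
  by rewrite (L2normBC _ w') [e]splitr EFinD; apply: ltW; apply: lteD.
move/(L2norm_eq0 mw'm); apply: filterS; first exact: (ae_filter_ringOfSetsType mu).
by move=> x H /H /eqP; rewrite subr_eq0 => /eqP.
Qed.

End minimization.

(** * Orthogonality of the extension of the minimizer *)

Section pythagoras.
Context {R : realType} (T : R) (f0 fT : R -> R) (K1 K2 : nat).
Hypotheses (T_gt0 : 0 < T) (smooth_f0 : smooth f0) (smooth_fT : smooth fT).
Notation mu := (@lebesgue_measure R).

Let K := (K1 + K2 + 1)%N.
Let s := t_right T f0 fT 1.
Let D := metric_domain T K1 K2.
Let c := - (2 * K1%:R * T).
Let g := vstar T f0 fT K1 K2.
Let NT_lt_T : - T < T. Proof. by rewrite gtrN. Qed.

(** The decrement from a point of [-T, T) to its translate in the i-th of the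
    K intervals of length 2T that tile the metric domain, from left to right.
    These are the functions t_1, ..., t_K in another order. *)
Definition cell_shift (i : nat) : R -> R :=
  if (K1 <= i)%N then t_right T f0 fT (i - K1) else t_left T f0 fT (K1 - i).

Let shift_continuous i : continuous (cell_shift i).
Proof.
by rewrite /cell_shift; case: ifP => _; [exact: t_right_continuous | exact: t_left_continuous].
Qed.

Let quasi_periodic_cell v i x : quasi_periodic T s v ->
  v (x + (c + i%:R * (2 * T))) = v x - cell_shift i x.
Proof.
move=> vs; rewrite /cell_shift; case: leqP => Ki.
  rewrite -quasi_periodic_right//; congr v.
  by rewrite /c natrB//; ring.
rewrite -quasi_periodic_left//; congr v.
by rewrite /c natrB 1?ltnW//; ring.
Qed.

Let sum_cell_shift x : \sum_(i < K) cell_shift i x = K%:R * t_mean T f0 fT K1 K2 x.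
Proof.
rewrite /t_mean -/K mulrA divff ?mul1r; last by rewrite pnatr_eq0 /K addn1.
transitivity (\sum_(0 <= k < K1) t_left T f0 fT k.+1 x +
              \sum_(0 <= k < K2) t_right T f0 fT k.+1 x).
  rewrite -(big_mkord xpredT (fun i => cell_shift i x)).
  rewrite (@big_cat_nat _ _ _ K1)//=; last by rewrite /K -addnA leq_addr.
  congr (_ + _).
    rewrite big_nat_rev/= !big_mkord; apply: eq_bigr => -[i /= iK] _.
    by rewrite /cell_shift add0n leqNgt ltn_subrL (leq_trans _ iK)//= subKn.
  rewrite -{1}[K1]add0n big_addn /K -addnA addKn addn1 big_nat_recl//=.
  rewrite /cell_shift leqnn subnn t_right0 add0r !big_mkord.
  by apply: eq_bigr => i _; rewrite leq_addl addnK.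
rewrite big_add1/= [RHS](@big_cat_nat _ _ _ K2.+1)//=; last first.
  by rewrite /K addnAC addn1 addSn ltnS leq_addl.
rewrite addrC; congr (_ + _).
  rewrite -{1}[K2.+1]add0n big_addn.
  have -> : (K - K2.+1 = K1)%N by rewrite /K addn1 subSS addnK.
  rewrite !big_mkord; apply: eq_bigr => -[i /= iK] _.
  rewrite /t_fun ltnS leqn0 addn_eq0 andbF -addSn.
  by rewrite leqNgt ltnS -addSnnS leq_addl/= addSnnS addnK.
rewrite big_nat_recl//= /t_fun/= add0r !big_mkord.
by apply: eq_bigr => -[i /= iK] _; rewrite ltnS iK subn1.
Qed.

Let DE : D = `[- T + c, - T + c + K%:R * (2 * T)]%classic.
Proof.
rewrite /D /metric_domain.
have -> : - ((2 * K1%:R + 1) * T) = - T + c by rewrite /c; ring.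
have -> : (2 * K2%:R + 1) * T = - T + c + K%:R * (2 * T).
  by rewrite /c /K !natrD; ring.
by [].
Qed.

Lemma vstar_C1 : exists g', (forall x : R, is_derive x 1 g (g' x)) /\ continuous g'.
Proof.
exists (t_mean T (derive1 f0) (derive1 fT) K1 K2); split.
  move=> x; rewrite -[X in is_derive _ _ _ X]addr0.
  by apply: is_derive1D; exact: is_derive_t_mean.
apply: is_derive_continuous => x; apply: is_derive_t_mean; exact: smooth_derive1.
Qed.

Let cg : continuous g.
Proof. by have [g' [dg _]] := vstar_C1; exact: is_derive_continuous dg. Qed.

(** This is what the constant A_1 is made for. *)
Lemma Rintegral_vstar : \int[mu]_(x in `[- T, T]) g x = constA T f0 fT.
Proof.
have ct : continuous (t_mean T f0 fT K1 K2).
  by apply: is_derive_continuous => x; exact: is_derive_t_mean.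
have ck : continuous (fun _ : R => constA1 T f0 fT K1 K2 / (2 * T)).
  exact: cst_continuous.
rewrite (@RintegralD _ _ _ mu _ _ _ _ (integrable_itv _ _ ct) (integrable_itv _ _ ck))//.
rewrite Rintegral_cst//= lebesgue_measure_itv/= lte_fin NT_lt_T -EFinD/=.
rewrite /constA1 (_ : T - - T = 2 * T) ?divfK; last by ring.
  by rewrite addrC subrK.
by rewrite mulf_neq0// gt_eqF.
Qed.

Let Rintegral_sum_itv n (G : nat -> R -> R) : (forall i, continuous (G i)) ->
  \sum_(i < n) \int[mu]_(x in `[- T, T]) G i x =
  \int[mu]_(x in `[- T, T]) \sum_(i < n) G i x.
Proof.
move=> cG; have csum k : continuous (fun x => \sum_(i < k) G i x).
  elim: k => [|k IH] x.
    by under eq_fun do rewrite big_ord0; exact: cvg_cst.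
  by under eq_fun do rewrite big_ord_recr/=; apply: cvgD; [exact: IH | exact: cG].
elim: n => [|n IH].
  rewrite big_ord0 (@eq_Rintegral _ _ _ mu _ (cst 0)); last first.
    by move=> x _; rewrite big_ord0.
  by rewrite Rintegral_cst// mul0r.
rewrite big_ord_recr IH /= -RintegralD//; last 2 first.
- exact/integrable_itv/csum.
- exact/integrable_itv/cG.
by apply: eq_Rintegral => x _; rewrite big_ord_recr.
Qed.

Variable m : R -> R.
Hypotheses (m_vstar : forall x, - T <= x < T -> m x = g x)
  (m_qp : quasi_periodic T s m).

Let pieces F G (cG : forall i, continuous (G i))
    (FG : forall i x, (i < K)%N -> - T <= x < T -> F (x + (c + i%:R * (2 * T))) = G i x) :
  mu.-integrable D (EFin \o F) /\
  \int[mu]_(x in D) F x = \sum_(i < K) \int[mu]_(x in `[- T, T]) G i x.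
Proof.
have L : - T + 2 * T = T by ring.
have := @Rintegral_pieces R (- T) c (2 * T) K F G.
by rewrite -DE L; apply => //; rewrite mulr_gt0.
Qed.

Let m_cell i x : (i < K)%N -> - T <= x < T ->
  m (x + (c + i%:R * (2 * T))) = g x - cell_shift i x.
Proof. by move=> _ xT; rewrite (quasi_periodic_cell i x m_qp) m_vstar. Qed.

Let mg_continuous i : continuous (fun x => g x - cell_shift i x).
Proof. by move=> x; apply: cvgB; [exact: cg | exact: shift_continuous]. Qed.

Lemma metric_domain_measurable : measurable D.
Proof. by rewrite DE; exact: measurable_itv. Qed.

Lemma minimizer_measurable : measurable_fun D m.
Proof.
have [intm _] := pieces mg_continuous m_cell.
by have /measurable_EFinP := measurable_int _ intm.
Qed.

Lemma minimizer_integrable_sqr : mu.-integrable D (EFin \o (fun x => m x ^+ 2)).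
Proof.
have [] // := @pieces (fun x => m x ^+ 2) (fun i x => (g x - cell_shift i x) ^+ 2).
- by move=> i x; apply: cvgM; exact: mg_continuous.
- by move=> i x iK xT; rewrite m_cell.
Qed.

Section input.
Variable v : R -> R.
Hypothesis Sv : input_space T f0 fT v.

Let cv : continuous v.
Proof. by have [] := input_space_quasi_periodic T_gt0 smooth_f0 smooth_fT Sv. Qed.

Let v_qp : quasi_periodic T s v.
Proof. by have [] := input_space_quasi_periodic T_gt0 smooth_f0 smooth_fT Sv. Qed.

Let vA : \int[mu]_(x in `[- T, T]) v x = constA T f0 fT.
Proof. by have [] := input_space_quasi_periodic T_gt0 smooth_f0 smooth_fT Sv. Qed.

Let c_diff : continuous (fun x => v x - g x).
Proof. by move=> x; apply: cvgB; [exact: cv | exact: cg]. Qed.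

Let diff_cell i x : (i < K)%N -> - T <= x < T ->
  v (x + (c + i%:R * (2 * T))) - m (x + (c + i%:R * (2 * T))) = v x - g x.
Proof.
move=> iK xT; rewrite m_cell// (quasi_periodic_cell i x v_qp).
by rewrite opprB addrA subrK.
Qed.

Lemma input_measurable : measurable_fun setT (v \_ D).
Proof.
apply/(measurable_restrictT _ metric_domain_measurable)/measurable_funTS.
exact: continuous_measurable_fun.
Qed.

(** The difference v - m is periodic, so the K intervals contribute equally. *)
Lemma difference_sqr : mu.-integrable D (EFin \o (fun x => (v x - m x) ^+ 2)) /\
  \int[mu]_(x in D) ((v x - m x) ^+ 2) =
    K%:R * \int[mu]_(x in `[- T, T]) ((v x - g x) ^+ 2).
Proof.
have [||int_d ->] := @pieces (fun x => (v x - m x) ^+ 2) (fun i x => (v x - g x) ^+ 2).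
- by move=> i x; apply: cvgM; exact: c_diff.
- by move=> i x iK xT; rewrite diff_cell.
by split => //; rewrite sumr_const card_ord mulr_natl.
Qed.

(** The factor v - m is the same on all the K intervals, and the values of m at
    the K translates of a point sum up to a constant; what remains is that
    constant times the integral of v - v* over [-T, T], which is A - A. *)
Lemma difference_orthogonal :
  mu.-integrable D (EFin \o (fun x => m x * (v x - m x))) /\
  \int[mu]_(x in D) (m x * (v x - m x)) = 0.
Proof.
pose G i x := (g x - cell_shift i x) * (v x - g x).
have cG i : continuous (G i).
  by move=> x; apply: cvgM; [exact: mg_continuous | exact: c_diff].
have [|int_d ->] := @pieces (fun x => m x * (v x - m x)) G cG.
  by move=> i x iK xT; rewrite diff_cell// m_cell.
split => //; rewrite Rintegral_sum_itv//.
pose C := K%:R * (constA1 T f0 fT K1 K2 / (2 * T)).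
have -> : \int[mu]_(x in `[- T, T]) (\sum_(i < K) G i x) =
    \int[mu]_(x in `[- T, T]) (C * (v x - g x)).
  apply: eq_Rintegral => x _; rewrite -mulr_suml; congr (_ * _).
  rewrite sumrB sum_cell_shift sumr_const card_ord -mulr_natl /g /vstar /C.
  by ring.
rewrite RintegralZl//; last exact: integrable_itv.
rewrite RintegralB//; [|exact: integrable_itv..].
by rewrite vA Rintegral_vstar subrr mulr0.
Qed.

Lemma input_pythagoras : exists d, [/\ 0 <= d,
  L2norm D (v \- m) = d%:E &
  L2norm D v = (Num.sqrt (Num.sqrt (\int[mu]_(x in D) (m x ^+ 2)) ^+ 2 + d ^+ 2))%:E].
Proof.
have mD := metric_domain_measurable.
have [int_d _] := difference_sqr; have [int_o o0] := difference_orthogonal.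
have int_m := minimizer_integrable_sqr.
have vE x : v x ^+ 2 = (m x ^+ 2 + (v x - m x) ^+ 2) + 2 * (m x * (v x - m x)).
  by ring.
have int_o2 : mu.-integrable D (EFin \o (fun x => 2 * (m x * (v x - m x)))).
  exact: (@integrableZl _ _ _ mu D mD 2 _ int_o).
have int_md : mu.-integrable D (EFin \o (fun x => m x ^+ 2 + (v x - m x) ^+ 2)).
  exact: (@integrableD _ _ _ mu D mD _ _ int_m int_d).
exists (Num.sqrt (\int[mu]_(x in D) ((v x - m x) ^+ 2))); split.
- exact: sqrtr_ge0.
- by rewrite L2normE.
rewrite !sqr_sqrtr; [|by apply: Rintegral_ge0 => x _; exact: sqr_ge0..].
rewrite L2normE//; last first.
  under [X in _ \o X]eq_fun do rewrite vE.
  exact: (@integrableD _ _ _ mu D mD _ _ int_md int_o2).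
congr (Num.sqrt _)%:E.
under eq_Rintegral do rewrite vE.
by rewrite RintegralD// RintegralZl// o0 mulr0 addr0 RintegralD.
Qed.

End input.

(** On the metric domain the squared distance is K times that on [-T, T]. *)
Lemma minimizer_approximable e : 0 < e ->
  exists2 v, input_space T f0 fT v & (L2norm D (v \- m)%R < e%:E)%E.
Proof.
move=> e0; have [g' [dg cg']] := vstar_C1.
have K0 : 0 < K%:R :> R by rewrite ltr0n /K addn1.
have eK : 0 < e ^+ 2 / K%:R by rewrite divr_gt0// exprn_gt0.
have [v [Sv vg]] := input_space_approximation T_gt0 smooth_f0 smooth_fT dg cg'
  Rintegral_vstar eK.
exists v => //; have [int_d dE] := difference_sqr Sv.
rewrite L2normE//; last exact: metric_domain_measurable.
rewrite lte_fin -[ltRHS]ger0_norm ?ltW// -sqrtr_sqr ltr_sqrt ?exprn_gt0//.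
by rewrite dE mulrC -ltr_pdivlMr.
Qed.

End pythagoras.

(** * Existence and limit of pre-minimum-input sequences *)

Theorem mainTheorem8 (R : realType) (T : R) (f0 fT : R -> R) (K1 K2 : nat)
    (T_gt0 : 0 < T) (smooth_f0 : smooth f0) (smooth_fT : smooth fT)
    (K1_ge1 : (1 <= K1)%N) (K2_ge1 : (1 <= K2)%N) :
  (exists u_ : nat -> R * R -> R, is_PMS T f0 fT K1 K2 u_) /\
  (forall u_ : nat -> R * R -> R, is_PMS T f0 fT K1 K2 u_ ->
    forall w : R -> R,
      L2 (metric_domain T K1 K2) w ->
      L2cvg (metric_domain T K1 K2) (fun n => input T (u_ n)) w ->
      {ae lebesgue_measure, forall x : R,
        `[- T, T]%classic x -> w x = vstar T f0 fT K1 K2 x}).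
Proof.
set D := metric_domain T K1 K2.
have mD : measurable D := metric_domain_measurable T K1 K2.
have [m [mg m_qp]] :=
  quasi_periodic_extension T_gt0 (t_right T f0 fT 1) (vstar T f0 fT K1 K2).
pose r := Num.sqrt (\int[lebesgue_measure]_(x in D) (m x ^+ 2)).
have int_m := minimizer_integrable_sqr T_gt0 smooth_f0 smooth_fT mg m_qp.
have m_L2 : L2 D m.
  by apply: L2_of_integrable_sqr => //; exact: minimizer_measurable mg m_qp.
have m_norm : L2norm D m = r%:E by rewrite L2normE.
have S_meas v (Sv : input_space T f0 fT v) : measurable_fun setT (v \_ D).
  exact: input_measurable Sv.
have pyth v (Sv : input_space T f0 fT v) :=
  input_pythagoras T_gt0 smooth_f0 smooth_fT mg m_qp Sv.
have approx e (e0 : 0 < e) :=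
  minimizer_approximable T_gt0 smooth_f0 smooth_fT mg m_qp e0.
have infE := ereal_inf_L2norm (sqrtr_ge0 _) m_L2 S_meas m_norm pyth approx.
split.
  have [v_ [Sv vm]] := approximating_sequence approx.
  have /choice[u_ u_P] : forall n, exists u, is_solution T f0 fT u /\ v_ n = input T u.
    by move=> n; have [u us vu] := Sv n; exists u.
  exists u_; split; first by move=> n; exact: (u_P n).1.
  exists m; split => //.
  by rewrite (_ : (fun n => _) = v_)//; apply/funext => n; rewrite (u_P n).2.
move=> u_ [u_sol [w0 [w0_L2 uw0 w0_norm]]] w w_L2 uw.
have Su n : input_space T f0 fT (input T (u_ n)) by exists (u_ n).
have w0_r : L2norm D w0 = r%:E by rewrite w0_norm infE.
have wm := minimizing_limit (sqrtr_ge0 _) m_L2 S_meas pyth Su w0_L2 w0_r uw0 w_L2 uw.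
(* At T the function m takes the value imposed by the law, in general not v*(T). *)
have not_T : {ae lebesgue_measure, forall x : R, x != T}.
  exists [set T]; split => //; first exact: lebesgue_measure_set1.
  by move=> x /= /negP; rewrite negbK => /eqP.
apply: filterS2 not_T wm; first exact: (ae_filter_ringOfSetsType lebesgue_measure).
move=> x xT wm /=; rewrite in_itv/= => /andP[Tx x_le_T].
have x_lt_T : x < T by rewrite lt_neqAle xT.
rewrite wm ?mg ?Tx//.
have K1T : 0 <= K1%:R * T by rewrite mulr_ge0// ltW.
have K2T : 0 <= K2%:R * T by rewrite mulr_ge0// ltW.
by rewrite /D /metric_domain /= in_itv/=; apply/andP; split; lra.
Qed.
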